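(* Let $Q=(Q_0:Q_1:Q_2)$ be a purely quadratic rational map of $\mathbb{P}^2(\mathbb{C})$ which is non-degenerate, i.e. $\det\mathrm{jac}\,Q\not\equiv 0$. Suppose that $Q$ contracts $\det\mathrm{jac}\,Q$. Then the cubic $\det\mathrm{jac}\,Q=0$ is a union of three non-concurrent lines (counted with multiplicity) and $Q$ is birational. Moreover: (i) if $\det\mathrm{jac}\,Q=0$ is the union of three lines in general position, then $Q$ is left-right equivalent to $\sigma=(x_1x_2:x_0x_2:x_0x_1)$; (ii) if $\det\mathrm{jac}\,Q=0$ is the union of a double line and a simple line, then $Q$ is left-right equivalent to $\rho=(x_0x_1:x_2^2:x_1x_2)$; (iii) if $\det\mathrm{jac}\,Q=0$ is a triple line, then $Q$ is left-right equivalent to $\tau=(x_0^2:x_0x_1:x_1^2-x_0x_2)$.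
   Context: ''Purely quadratic'' means that $Q_0,Q_1,Q_2\in\mathbb{C}[x_0,x_1,x_2]$ are homogeneous of degree $2$ without common factor. $\det\mathrm{jac}\,Q=\det(\partial Q_i/\partial x_j)$, a homogeneous polynomial of degree $3$ (or zero). The indeterminacy set $\mathrm{Ind}\,Q$ is the set of common zeros of the $Q_i$. $Q$ contracts a homogeneous polynomial $\psi$ if the image under $Q$ of $\{\psi=0\}\setminus\mathrm{Ind}\,Q$ is a finite set. ''Three non-concurrent lines (counted with multiplicity)'' excludes the configuration of three pairwise distinct lines through a common point, so that the possible configurations are exactly those of (i), (ii), (iii). Two rational maps $Q,Q'$ are left-right equivalent if $Q'=AQB^{-1}$ for some $A,B\in\mathrm{PGL}_3(\mathbb{C})=\mathrm{Aut}(\mathbb{P}^2(\mathbb{C}))$. *)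

(* Defs.v *)
From mathcomp Require Import all_boot all_order all_algebra.
From mathcomp Require Import classical_sets cardinality reals complex mpoly.

Set Implicit Arguments.
Unset Strict Implicit.
Unset Printing Implicit Defensive.

Import GRing.Theory.
Local Open Scope ring_scope.
Local Open Scope classical_set_scope.

Section PlaneMaps.
Variable C : fieldType.

(* The points of the projective plane are the lines <[x]>, x != 0, of C^3;
   a rational map is represented by a triple of forms of the same degree. *)
Notation form := {mpoly C[3]}.
Notation triple := (3.-tuple {mpoly C[3]}).
Implicit Types (F G Q : triple) (l m psi : form) (x : 'rV[C]_3).

Definition homog_triple (d : nat) F : Prop :=
  forall i, tnth F i \is d.-homog.

Definition nonzero_triple F : Prop := exists i, tnth F i != 0.

Definition no_common_factor F : Prop :=
  forall p : form, (forall i, exists q : form, tnth F i = p * q) ->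
    p \is a GRing.unit.

Definition purely_quadratic Q : Prop := homog_triple 2 Q /\ no_common_factor Q.

Definition det_jac Q : form := \det (\matrix_(i, j) mderiv j (tnth Q i)).

Definition eval_triple F x : 'rV[C]_3 := \row_i (tnth F i).@[x 0].

Definition Ind F : set 'rV[C]_3 := [set x | forall i, (tnth F i).@[x 0] = 0].

Definition contracts Q psi : Prop :=
  finite_set [set <[eval_triple Q x]>%VS
             | x in [set x : 'rV[C]_3 | x != 0 /\ psi.@[x 0] = 0] `\` Ind Q].

(* F and G are proportional over the field of rational functions. *)
Definition same_map F G : Prop :=
  [/\ nonzero_triple F, nonzero_triple G &
      forall i j, tnth F i * tnth G j = tnth F j * tnth G i].

Definition comp_triple F G : triple := [tuple tnth F i \mPo G | i < 3].

Definition id_triple : triple := [tuple 'X_i | i < 3].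

(* same_map includes the requirement that both composites be defined, that is,
   not identically zero. *)
Definition birational Q : Prop :=
  exists (d : nat) G,
    [/\ homog_triple d G,
        same_map (comp_triple G Q) id_triple &
        same_map (comp_triple Q G) id_triple].

Definition linear_triple (A : 'M[C]_3) : triple :=
  [tuple \sum_j A i j *: 'X_j | i < 3].

Definition left_right_equivalent Q Q' : Prop :=
  exists A B : 'M[C]_3,
    [/\ A \in unitmx, B \in unitmx &
        same_map Q'
          (comp_triple (linear_triple A)
            (comp_triple Q (linear_triple (invmx B))))].

(* A line of the plane is given by a nonzero linear form, up to a scalar. *)
Definition is_line l : Prop := l \is 1.-homog /\ l != 0.

Definition same_line l m : Prop := exists2 c : C, c != 0 & m = c *: l.

Definition pairwise_distinct l0 l1 l2 : Prop :=
  [/\ ~ same_line l0 l1, ~ same_line l0 l2 & ~ same_line l1 l2].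

Definition concurrent l0 l1 l2 : Prop :=
  exists2 x : 'rV[C]_3, x != 0 & [/\ l0.@[x 0] = 0, l1.@[x 0] = 0 & l2.@[x 0] = 0].

Definition general_position l0 l1 l2 : Prop :=
  pairwise_distinct l0 l1 l2 /\ ~ concurrent l0 l1 l2.

(* Only three distinct lines through a point are excluded: repeated lines are
   allowed, although they always have a common point. *)
Definition non_concurrent l0 l1 l2 : Prop :=
  ~ (pairwise_distinct l0 l1 l2 /\ concurrent l0 l1 l2).

(* Equality of divisors: lines are counted with multiplicity. *)
Definition union_of_lines psi l0 l1 l2 : Prop :=
  [/\ is_line l0, is_line l1, is_line l2 &
      exists2 c : C, c != 0 & psi = c *: (l0 * l1 * l2)].

Definition x0 : form := 'X_(inord 0).
Definition x1 : form := 'X_(inord 1).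
Definition x2 : form := 'X_(inord 2).

Definition sigma : triple := [tuple x1 * x2; x0 * x2; x0 * x1].
Definition rho : triple := [tuple x0 * x1; x2 ^+ 2; x1 * x2].
Definition tau : triple := [tuple x0 ^+ 2; x0 * x1; x1 ^+ 2 - x0 * x2].

End PlaneMaps.

Arguments sigma {C}.
Arguments rho {C}.
Arguments tau {C}.

(* Main.v *)
(** A fibre of Q over the contracted cubic contains five points, so after a
    linear change of the target two components of Q vanish at five points of
    the plane, and hence share a linear factor: Q = (q : l a : l b).  According
    to whether l lies in the span of a and b, linear coordinates bring the last
    two components to (x0^2, x0 x1) or to (x0 x1, x0 x2).  The Jacobian is then
    x0 times an explicit quadratic form, and the contraction of its zero locus
    kills exactly the coefficient of q that prevents Q from being equivalent to
    one of sigma, rho, tau.  These three maps are involutions, and the divisor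
    of their Jacobian tells them apart. *)
Require Import Defs.
From mathcomp Require Import all_boot all_order all_algebra.
From mathcomp Require Import boolp classical_sets functions cardinality reals complex mpoly.
From mathcomp Require Import finmap ring.

Set Implicit Arguments.
Unset Strict Implicit.
Unset Printing Implicit Defensive.

Import Order.TTheory GRing.Theory Num.Theory.
Local Open Scope ring_scope.

(** * Coordinates and linear substitutions *)

Local Notation i0 := (inord 0 : 'I_3).
Local Notation i1 := (inord 1 : 'I_3).
Local Notation i2 := (inord 2 : 'I_3).

(** Five is one more than the number of points that two conics without a common component can share.
    To have infinitely many points for the pigeonhole, the cubic is cut by the lines x2 = n x1
    through a point off it, moved to (1:0:0). The Jacobian matrix of a quadratic map is linear in
    the point, so each intersection is an eigenvalue problem over an algebraically closed field.
    Points of indeterminacy among them do no harm, a zero value being a multiple of every vector.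
    The hypotheses travel as [hyp], which survives linear changes on both sides, so each
    normalisation may forget the previous map. Contraction acts a second time on the part of the
    cubic off x0 = 0: a quotient of two components of Q would take infinitely many values there
    unless the offending coefficient vanishes. The final case distinction rests on the fact that the
    zero locus of the cubic determines its lines. *)

Lemma ord3_ind (P : 'I_3 -> Prop) : P i0 -> P i1 -> P i2 -> forall i, P i.
Proof.
move=> P0 P1 P2 [[|[|[|//]]] lt_i3].
- by have -> : Ordinal lt_i3 = i0 by apply: val_inj; rewrite /= inordK.
- by have -> : Ordinal lt_i3 = i1 by apply: val_inj; rewrite /= inordK.
- by have -> : Ordinal lt_i3 = i2 by apply: val_inj; rewrite /= inordK.
Qed.

Lemma big_ord3 (R : Type) (idx : R) (op : Monoid.law idx) (F : 'I_3 -> R) :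
  \big[op/idx]_(i < 3) F i = op (op (F i0) (F i1)) (F i2).
Proof.
rewrite !big_ord_recl big_ord0 Monoid.mulm1 Monoid.mulmA.
by congr (op (op (F _) (F _)) (F _)); apply: val_inj; rewrite /= ?inordK.
Qed.

Lemma sum_ord3 (V : nmodType) (F : 'I_3 -> V) :
  \sum_(i < 3) F i = F i0 + F i1 + F i2.
Proof. exact: big_ord3. Qed.

Lemma tnth3E (T : Type) (a b c : T) :
  (tnth [tuple a; b; c] i0 = a) * (tnth [tuple a; b; c] i1 = b) *
  (tnth [tuple a; b; c] i2 = c).
Proof. by rewrite !(tnth_nth a) /= !inordK. Qed.

Lemma eq_ord3 : (i0 == i0) * (i1 == i1) * (i2 == i2) * ((i0 == i1) = false) *
  ((i0 == i2) = false) * ((i1 == i0) = false) * ((i1 == i2) = false) *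
  ((i2 == i0) = false) * ((i2 == i1) = false).
Proof. by rewrite -!val_eqE /= !inordK. Qed.

Lemma det3E (R : comNzRingType) (M : 'M[R]_3) : \det M =
  M i0 i0 * (M i1 i1 * M i2 i2 - M i1 i2 * M i2 i1)
  - M i0 i1 * (M i1 i0 * M i2 i2 - M i1 i2 * M i2 i0)
  + M i0 i2 * (M i1 i0 * M i2 i1 - M i1 i1 * M i2 i0).
Proof.
pose f a b := M (inord a) (inord b).
have -> : M = \matrix_(i, j) f i j.
  by apply/matrixP => i j; rewrite mxE /f !inord_val.
rewrite (expand_det_row _ ord0) !big_ord_recl big_ord0 /cofactor.
rewrite !(expand_det_row _ ord0) !big_ord_recl !big_ord0 /cofactor !det_mx11.
by rewrite !mxE /= !inordK // /bump /=; ring.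
Qed.

Section Basics.
Variable C : fieldType.
Notation form := {mpoly C[3]}.
Notation triple := (3.-tuple {mpoly C[3]}).

Definition vec3 (a b c : C) : 'rV[C]_3 := \row_i tnth [tuple a; b; c] i.

Definition mat3 (r0 r1 r2 : 'rV[C]_3) : 'M[C]_3 :=
  \matrix_(i, j) tnth [tuple r0; r1; r2] i 0 j.

Lemma vec3E a b c : (vec3 a b c 0 i0 = a) * (vec3 a b c 0 i1 = b) *
  (vec3 a b c 0 i2 = c).
Proof. by rewrite !mxE !tnth3E. Qed.

Lemma mat3E r0 r1 r2 j : (mat3 r0 r1 r2 i0 j = r0 0 j) *
  (mat3 r0 r1 r2 i1 j = r1 0 j) * (mat3 r0 r1 r2 i2 j = r2 0 j).
Proof. by rewrite !mxE !tnth3E. Qed.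

Lemma vec3_eta (v : 'rV[C]_3) : v = vec3 (v 0 i0) (v 0 i1) (v 0 i2).
Proof.
by apply/rowP; elim/ord3_ind; rewrite vec3E.
Qed.

Definition lform (r : 'rV[C]_3) : form := \sum_j r 0 j *: 'X_j.

Lemma lformE r : lform r = r 0 i0 *: x0 C + r 0 i1 *: x1 C + r 0 i2 *: x2 C.
Proof. by rewrite /lform sum_ord3. Qed.

(** Serves identities compatible with sums and products, such as associativity of substitution and
    the chain rule. *)
Lemma mpoly_gen_ind (P : form -> Prop) : (forall c, P c%:MP) ->
  (forall i, P 'X_i) -> (forall p q, P p -> P q -> P (p + q)) ->
  (forall p q, P p -> P q -> P (p * q)) -> forall p, P p.
Proof.
move=> PC PX PD PM p; rewrite [p]mpolyE.
elim/big_ind: _ => //; first by rewrite -mpolyC0.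
move=> m _; rewrite -mul_mpolyC; apply: (PM) => //.
rewrite mpolyXE_id; elim/big_ind: _ => //; first by rewrite -mpolyC1.
move=> i _; elim: (m i) => [|k IHk]; first by rewrite expr0 -mpolyC1.
by rewrite exprS; apply: PM.
Qed.

Lemma meval_comp_lin (x : 'rV_3) (p : form) B :
  (p \mPo linear_triple B).@[x 0] = p.@[(x *m B^T) 0].
Proof.
rewrite comp_mpoly_meval; apply: meval_eq => i.
rewrite tnth_mktuple raddf_sum mxE; apply: eq_bigr => j _.
by rewrite /= mevalZ mevalXU !mxE mulrC.
Qed.

Lemma lform_comp r B : lform r \mPo linear_triple B = lform (r *m B).
Proof.
rewrite /lform raddf_sum /=.
under eq_bigr => j _ do
  rewrite comp_mpolyZ comp_mpolyXU -tnth_nth tnth_mktuple scaler_sumr.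
rewrite exchange_big /=; apply: eq_bigr => j _.
by rewrite mxE scaler_suml; apply: eq_bigr => k _; rewrite scalerA.
Qed.

Lemma comp_linA (p : form) A B :
  (p \mPo linear_triple A) \mPo linear_triple B = p \mPo linear_triple (A *m B).
Proof.
elim/mpoly_gen_ind: p => [c|i|p q IHp IHq|p q IHp IHq].
- by rewrite !comp_mpolyC.
- rewrite !comp_mpolyXU -!tnth_nth !tnth_mktuple.
  have -> : \sum_j A i j *: 'X_j = lform (row i A).
    by apply: eq_bigr => j _; rewrite mxE.
  rewrite lform_comp -row_mul.
  by apply: eq_bigr => j _; rewrite !mxE.
- by rewrite !comp_mpolyD IHp IHq.
- by rewrite !rmorphM /= IHp IHq.
Qed.

Lemma comp_lin1 (p : form) : p \mPo linear_triple 1%:M = p.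
Proof.
rewrite -[RHS]comp_mpoly_id; congr (_ \mPo _); apply: eq_from_tnth => i.
rewrite !tnth_mktuple (bigD1 i) //= big1 ?addr0; last first.
  by move=> j ji; rewrite mxE eq_sym (negPf ji) scale0r.
by rewrite mxE eqxx scale1r.
Qed.

Lemma comp_linK B (p : form) : B \in unitmx ->
  (p \mPo linear_triple B) \mPo linear_triple (invmx B) = p.
Proof. by move=> uB; rewrite comp_linA mulmxV // comp_lin1. Qed.

Lemma comp_linVK B (p : form) : B \in unitmx ->
  (p \mPo linear_triple (invmx B)) \mPo linear_triple B = p.
Proof. by move=> uB; rewrite comp_linA mulVmx // comp_lin1. Qed.

Lemma comp_lin_eq0 B (p : form) : B \in unitmx ->
  (p \mPo linear_triple B == 0) = (p == 0).
Proof.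
move=> uB; apply/eqP/eqP => [pB0|->]; last by rewrite comp_mpoly0.
by rewrite -(comp_linK p uB) pB0 comp_mpoly0.
Qed.

Lemma mderivXU i j : mderiv j ('X_i : form) = (i == j)%:R.
Proof.
rewrite mderivX mnmE; have [->|_] := eqVneq i j; last by rewrite scale0r.
rewrite scale1r (_ : (_ - _)%MM = 0%MM) ?mpolyX0 //.
by apply/mnmP => k; rewrite mnmBE subnn mnm0E.
Qed.

(** Chain rule: both sides are additive in [p] and obey the same Leibniz rule, so constants and
    variables suffice. *)
Lemma mderiv_comp (p : form) (G : triple) j :
  mderiv j (p \mPo G) =
  \sum_k (mderiv k p \mPo G) * mderiv j (tnth G k).
Proof.
elim/mpoly_gen_ind: p => [c|i|p q IHp IHq|p q IHp IHq].
- rewrite comp_mpolyC mderivC big1 // => k _.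
  by rewrite mderivC comp_mpoly0 mul0r.
- rewrite comp_mpolyXU -tnth_nth (bigD1 i) //= big1 => [|k ki]; last first.
    by rewrite mderivXU eq_sym (negPf ki) comp_mpoly0 mul0r.
  by rewrite mderivXU eqxx comp_mpoly1 mul1r addr0.
- rewrite comp_mpolyD mderivD IHp IHq -big_split /=; apply: eq_bigr => k _.
  by rewrite mderivD comp_mpolyD mulrDl.
- rewrite rmorphM /= mderivM IHp IHq mulr_suml mulr_sumr -big_split /=.
  apply: eq_bigr => k _.
  by rewrite mderivM comp_mpolyD !rmorphM /=; ring.
Qed.

End Basics.

(** * Forms of low degree and the two linear actions *)

Section Homog.
Variable C : fieldType.
Notation form := {mpoly C[3]}.
Notation triple := (3.-tuple {mpoly C[3]}).

Lemma lform_homog (r : 'rV[C]_3) : lform r \is 1.-homog.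
Proof.
rewrite rpred_sum // => j _; apply: dhomogZ.
by rewrite dhomogX /= mdeg1.
Qed.

Lemma mderiv_homog d (p : form) j : p \is d.+1.-homog -> mderiv j p \is d.-homog.
Proof.
move=> hp; apply/dhomogP => m; rewrite mcoeff_msupp mcoeff_mderiv => nz.
have /(dhomog_mf hp) /= : (m + U_(j))%MM \in msupp p.
  by rewrite mcoeff_msupp; apply: contraNneq nz => ->; rewrite mul0rn.
by rewrite mdegD mdeg1 addn1 => -[].
Qed.

Lemma euler_homog d (p : form) : p \is d.-homog ->
  \sum_j 'X_j * mderiv j p = d%:R *: p.
Proof.
move=> hp; rewrite [in LHS](mpolyE p) [in RHS](mpolyE p) scaler_sumr.
under eq_bigr => j _ do rewrite raddf_sum mulr_sumr.
rewrite exchange_big /= big_seq [RHS]big_seq; apply: eq_bigr => m mp.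
have <- := dhomog_mf hp mp; rewrite /= mdegE natr_sum scaler_suml.
apply: eq_bigr => j _; rewrite mderivZ mderivX scalerA -scalerAr -mpolyXD addmC.
rewrite scalerA mulrC.
(* Subtraction of exponents truncates when [m j] is 0, but then the coefficient [m j] kills the
   term. *)
have [->|nz] := eqVneq (m j) 0%N; first by rewrite !mul0r !scale0r.
by rewrite submK // lep1mP.
Qed.

Lemma homog0E (p : form) : p \is 0.-homog -> exists c, p = c%:MP.
Proof.
move=> hp; exists p@_0; apply/mpolyP => m; rewrite mcoeffC.
have [->|nz] := eqVneq 0%MM m; first by rewrite mulr1.
rewrite mulr0; apply: (dhomog_nemf_coeff hp) => /=.
by rewrite mdeg_eq0 eq_sym.
Qed.

Lemma homog1E (p : form) : p \is 1.-homog -> exists r, p = lform r.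
Proof.
move=> hp; have hd j : {c : C | mderiv j p = c%:MP}.
  by apply: cid; apply: homog0E; apply: mderiv_homog.
exists (\row_j sval (hd j)); rewrite -[LHS]scale1r -(euler_homog hp).
apply: eq_bigr => j _; rewrite (svalP (hd j)) mxE mulrC.
by rewrite mul_mpolyC.
Qed.

Definition qform (a b c d e f : C) : form :=
  a *: x0 C ^+ 2 + b *: x1 C ^+ 2 + c *: x2 C ^+ 2
  + d *: (x0 C * x1 C) + e *: (x0 C * x2 C) + f *: (x1 C * x2 C).

(** Euler's identity rebuilds 2p from the partial derivatives, which are linear forms; hence the
    division by 2. *)
Lemma homog2E (p : form) : (2%:R : C) != 0 -> p \is 2.-homog ->
  exists a b c d e f, p = qform a b c d e f.
Proof.
move=> nz2 hp; have hd j : {r | mderiv j p = lform r}.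
  by apply: cid; apply: homog1E; apply: mderiv_homog.
have E : p = 2%:R^-1 *: \sum_j 'X_j * mderiv j p.
  by rewrite (euler_homog hp) scalerA mulVf // scale1r.
move: E; rewrite sum_ord3.
case: (hd i0) (hd i1) (hd i2) => [u ->] [v ->] [w ->] ->.
rewrite !lformE; set k := 2%:R^-1.
exists (k * u 0 i0), (k * v 0 i1), (k * w 0 i2), (k * (u 0 i1 + v 0 i0)),
  (k * (u 0 i2 + w 0 i0)), (k * (v 0 i2 + w 0 i1)).
rewrite /qform -!/(x0 C) -!/(x1 C) -!/(x2 C) -!mul_mpolyC !mpolyCM !mpolyCD.
by ring.
Qed.

Lemma homog_comp_lin d (p : form) B : p \is d.-homog ->
  p \mPo linear_triple B \is d.-homog.
Proof.
move=> hp; rewrite comp_mpolyEX big_seq rpred_sum // => m mp; apply: dhomogZ.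
rewrite comp_mpolyX.
have <- := dhomog_mf hp mp; rewrite /= mdegE sum_ord3 big_ord3.
have h i : tnth (linear_triple B) i ^+ m i \is (m i).-homog.
  rewrite -[X in X.-homog]mul1n; apply: dhomogMn; rewrite tnth_mktuple.
  by rewrite (_ : \sum_j _ = lform (row i B)) ?lform_homog //;
     apply: eq_bigr => j _; rewrite mxE.
by apply: dhomogM; rewrite ?h //; apply: dhomogM; rewrite ?h.
Qed.

End Homog.

Section Actions.
Variable C : fieldType.
Notation form := {mpoly C[3]}.
Notation triple := (3.-tuple {mpoly C[3]}).

Definition lact A (Q : triple) : triple := comp_triple (linear_triple A) Q.
Definition ract (Q : triple) B : triple := comp_triple Q (linear_triple B).

Lemma tnth_lact A Q i : tnth (lact A Q) i = \sum_j A i j *: tnth Q j.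
Proof.
rewrite !tnth_mktuple raddf_sum; apply: eq_bigr => j _ /=.
by rewrite comp_mpolyZ comp_mpolyXU -tnth_nth.
Qed.

Lemma tnth_ract Q B i : tnth (ract Q B) i = tnth Q i \mPo linear_triple B.
Proof. by rewrite tnth_mktuple. Qed.

Lemma lactM A B Q : lact A (lact B Q) = lact (A *m B) Q.
Proof.
apply: eq_from_tnth => i; rewrite !tnth_lact.
under eq_bigr => j _ do rewrite tnth_lact scaler_sumr.
rewrite exchange_big /=; apply: eq_bigr => j _.
by rewrite mxE scaler_suml; apply: eq_bigr => k _; rewrite scalerA.
Qed.

Lemma lact1 Q : lact 1%:M Q = Q.
Proof.
apply: eq_from_tnth => i; rewrite tnth_lact (bigD1 i) //= big1 ?addr0.
  by rewrite mxE eqxx scale1r.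
by move=> j ji; rewrite mxE eq_sym (negPf ji) scale0r.
Qed.

Lemma lactK A Q : A \in unitmx -> lact (invmx A) (lact A Q) = Q.
Proof. by move=> uA; rewrite lactM mulVmx // lact1. Qed.

Lemma ractM A B Q : ract (ract Q A) B = ract Q (A *m B).
Proof. by apply: eq_from_tnth => i; rewrite !tnth_ract comp_linA. Qed.

Lemma ract1 Q : ract Q 1%:M = Q.
Proof. by apply: eq_from_tnth => i; rewrite tnth_ract comp_lin1. Qed.

Lemma lact_ract A B Q : lact A (ract Q B) = ract (lact A Q) B.
Proof.
apply: eq_from_tnth => i; rewrite tnth_lact tnth_ract tnth_lact raddf_sum.
by apply: eq_bigr => j _ /=; rewrite comp_mpolyZ tnth_ract.
Qed.

(** Points are row vectors while matrices act on coordinates as on columns: this is the source of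
    every transpose below. *)
Lemma eval_lact A Q x : eval_triple (lact A Q) x = eval_triple Q x *m A^T.
Proof.
apply/rowP => i; rewrite !mxE tnth_lact raddf_sum; apply: eq_bigr => j _ /=.
by rewrite mevalZ !mxE mulrC.
Qed.

Lemma eval_ract B Q x : eval_triple (ract Q B) x = eval_triple Q (x *m B^T).
Proof. by apply/rowP => i; rewrite !mxE tnth_ract meval_comp_lin. Qed.

Definition jac (Q : triple) : 'M[form]_3 := \matrix_(i, j) mderiv j (tnth Q i).

Lemma jac_lact A Q : jac (lact A Q) = map_mx (@mpolyC 3 C) A *m jac Q.
Proof.
apply/matrixP => i j; rewrite !mxE tnth_lact raddf_sum; apply: eq_bigr => k _ /=.
by rewrite mderivZ !mxE mul_mpolyC.
Qed.

Lemma det_jac_lact A Q : det_jac (lact A Q) = \det A *: det_jac Q.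
Proof.
by rewrite /det_jac -!/(jac _) jac_lact det_mulmx det_map_mx mul_mpolyC.
Qed.

Lemma mderiv_lform j (r : 'rV[C]_3) : mderiv j (lform r) = (r 0 j)%:MP.
Proof.
rewrite raddf_sum (bigD1 j) //= big1 => [|k kj].
  by rewrite addr0 mderivZ mderivXU eqxx -mul_mpolyC mulr1.
by rewrite mderivZ mderivXU (negPf kj) scaler0.
Qed.

Lemma tnth_linear_triple (A : 'M[C]_3) i : tnth (linear_triple A) i = lform (row i A).
Proof. by rewrite tnth_mktuple; apply: eq_bigr => j _; rewrite mxE. Qed.

Lemma jac_ract B Q : jac (ract Q B) =
  map_mx (comp_mpoly (linear_triple B)) (jac Q) *m map_mx (@mpolyC 3 C) B.
Proof.
apply/matrixP => i j; rewrite !mxE tnth_ract mderiv_comp; apply: eq_bigr => k _.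
by rewrite !mxE tnth_linear_triple mderiv_lform mxE.
Qed.

Lemma det_jac_ract B Q :
  det_jac (ract Q B) = \det B *: (det_jac Q \mPo linear_triple B).
Proof.
rewrite /det_jac -!/(jac _) jac_ract det_mulmx !det_map_mx mulrC.
by rewrite mul_mpolyC.
Qed.

End Actions.

(** * The pigeonhole form of contraction *)

Section Hyp.
Variable C : fieldType.
Notation form := {mpoly C[3]}.
Notation triple := (3.-tuple {mpoly C[3]}).
Local Open Scope classical_set_scope.

(* The finiteness of the image is only used through the pigeonhole principle. *)
Definition pigeon (Q : triple) : Prop :=
  forall x : nat -> 'rV[C]_3,
    (forall n, x n != 0 /\ (det_jac Q).@[x n 0] = 0) ->
  exists p (s : seq nat), [/\ p != 0, uniq s, size s = 5 &
    forall n, n \in s -> exists c, eval_triple Q (x n) = c *: p].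

(** Otherwise [nat] would be a finite union of finite fibres. *)
Lemma infinite_fiber (T : Type) (f : nat -> T) : finite_set (range f) ->
  exists y, infinite_set (f @^-1` [set y]).
Proof.
move=> finf; apply: contrapT => /forallNP all_fin; apply: infinite_nat.
rewrite (_ : [set: nat] = \bigcup_(y in range f) (f @^-1` [set y])).
  by apply: bigcup_finite => // y _; apply: contrapT; apply: all_fin.
by apply/seteqP; split=> // n _; exists (f n) => //; exists n.
Qed.

Lemma contracts_pigeon Q : contracts Q (det_jac Q) -> pigeon Q.
Proof.
move=> fin x xP; pose f n := <[eval_triple Q (x n)]>%VS.
have finf : finite_set (range f).
  (* The zero subspace, which is the value of [f] at points of indeterminacy, is added to the finite
     image given by [contracts]. *)
  pose U := [set <[eval_triple Q y]>%VS | y in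
    [set y : 'rV[C]_3 | y != 0 /\ (det_jac Q).@[y 0] = 0] `\` Ind Q] `|` [set 0%VS].
  apply: (@sub_finite_set _ _ U); last first.
    by rewrite finite_setU; split=> //; apply: finite_set1.
  move=> _ [n _ <-]; have [IQ|nIQ] := pselect (Ind Q (x n)); last first.
    by left; exists (x n) => //; split=> //; apply: xP.
  have v0 : eval_triple Q (x n) = 0 by apply/rowP => i; rewrite !mxE IQ.
  right; rewrite /= /f v0; apply/eqP; rewrite -subv0; apply/subvP => v.
  by case/vlineP => k ->; rewrite scaler0 mem0v.
have [V infV] := infinite_fiber finf.
have [X XV sX] := infinite_set_fset 5 infV.
pose s := take 5 (enum_fset X).
have sV n : n \in s -> f n = V by move=> /mem_take nX; apply: XV.
have us : uniq s by rewrite take_uniq // fset_uniq.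
have ss : size s = 5 by rewrite size_takel.
have [n0 n0s] : exists n0, n0 \in s.
  by case: (s) ss => // a t _; exists a; rewrite inE eqxx.
have sub n : n \in s -> exists c, eval_triple Q (x n) = c *: eval_triple Q (x n0).
  by move=> /sV fn; apply/vlineP; rewrite -/(f n0) (sV _ n0s) -fn memv_line.
(* If the chosen fibre consists of points of indeterminacy, any nonzero vector serves as [p], with
   coefficients 0. *)
have [v0|v0] := eqVneq (eval_triple Q (x n0)) 0; last first.
  by exists (eval_triple Q (x n0)), s.
exists (const_mx 1), s; split=> //.
  by apply/eqP => /rowP/(_ i0); rewrite !mxE; apply/eqP; rewrite oner_eq0.
by move=> n /sub[c ->]; exists 0; rewrite v0 scale0r scaler0.
Qed.

(** Shape of the hypotheses that both linear actions preserve: [pigeon] is transported by simply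
    moving the points or the vector [p]. *)
Definition hyp (Q : triple) : Prop :=
  [/\ homog_triple 2 Q, no_common_factor Q, det_jac Q != 0 & pigeon Q].

Lemma no_common_factor_lact A (Q : triple) : A \in unitmx ->
  no_common_factor Q -> no_common_factor (lact A Q).
Proof.
move=> uA ncf p pP; apply: ncf => i.
pose q j := projT1 (cid (pP j)).
exists (\sum_j invmx A i j *: q j); rewrite -[in LHS](lactK Q uA) tnth_lact mulr_sumr.
by apply: eq_bigr => j _; rewrite -scalerAr -(projT2 (cid (pP j))).
Qed.

Lemma no_common_factor_ract B (Q : triple) : B \in unitmx ->
  no_common_factor Q -> no_common_factor (ract Q B).
Proof.
move=> uB ncf p pP; rewrite -(comp_linVK p uB); apply: rmorph_unit; apply: ncf => i.
have [q qP] := pP i; exists (q \mPo linear_triple (invmx B)).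
by rewrite -rmorphM /= -qP tnth_ract comp_linK.
Qed.

Lemma homog_lact A (Q : triple) d : homog_triple d Q -> homog_triple d (lact A Q).
Proof.
by move=> hQ i; rewrite tnth_lact rpred_sum // => j _; apply: dhomogZ; apply: hQ.
Qed.

Lemma homog_ract B (Q : triple) d : homog_triple d Q -> homog_triple d (ract Q B).
Proof. by move=> hQ i; rewrite tnth_ract; apply: homog_comp_lin. Qed.

Lemma hyp_lact A Q : A \in unitmx -> hyp Q -> hyp (lact A Q).
Proof.
move=> uA [hQ ncf J0 pQ].
have dA : \det A != 0 by rewrite -unitfE -unitmxE.
split; [exact: homog_lact | exact: no_common_factor_lact | |].
  by rewrite det_jac_lact scaler_eq0 negb_or dA.
move=> x xP; have [n|p [s [p0 us ss sP]]] := pQ x.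
  have [xn] := xP n; rewrite det_jac_lact mevalZ => JAx; split; first exact: xn.
  by apply: (mulfI dA); rewrite mulr0.
have uAT : A^T \in unitmx by rewrite unitmx_tr.
exists (p *m A^T), s; split=> //.
  by apply: contraNneq p0 => pA; rewrite -(mulmxK uAT p) pA mul0mx.
by move=> n /sP[c cP]; exists c; rewrite eval_lact cP scalemxAl.
Qed.

Lemma hyp_ract B Q : B \in unitmx -> hyp Q -> hyp (ract Q B).
Proof.
move=> uB [hQ ncf J0 pQ].
have dB : \det B != 0 by rewrite -unitfE -unitmxE.
have uBT : B^T \in unitmx by rewrite unitmx_tr.
split; [exact: homog_ract | exact: no_common_factor_ract | |].
  by rewrite det_jac_ract scaler_eq0 negb_or dB comp_lin_eq0.
move=> x xP; have [n|p [s [p0 us ss sP]]] := pQ (fun n => x n *m B^T).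
  have [xn] := xP n; rewrite det_jac_ract mevalZ meval_comp_lin => /eqP.
  rewrite mulf_eq0 (negPf dB) => /eqP ->; split=> //.
  by apply: contraNneq xn => xB; rewrite -(mulmxK uBT (x n)) xB mul0mx.
by exists p, s; split=> // n /sP; rewrite eval_ract.
Qed.

End Hyp.

(** * Left-right equivalence and five points in a fibre *)

Section Equivalence.
Variable C : fieldType.
Notation triple := (3.-tuple {mpoly C[3]}).
Implicit Types Q : triple.

(** Equality of triples instead of proportionality, a scalar being absorbed in [A]; Jacobians can
    then be transported exactly. *)
Definition lr_equiv (Q Q' : triple) : Prop :=
  exists A B, [/\ A \in unitmx, B \in unitmx & Q' = lact A (ract Q B)].

Lemma lr_equiv_sym Q Q' : lr_equiv Q Q' -> lr_equiv Q' Q.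
Proof.
move=> [A [B [uA uB ->]]]; exists (invmx A), (invmx B); rewrite !unitmx_inv.
by split=> //; rewrite -lact_ract lactK // ractM mulmxV // ract1.
Qed.

Lemma lr_equiv_trans Q Q' Q'' : lr_equiv Q Q' -> lr_equiv Q' Q'' -> lr_equiv Q Q''.
Proof.
move=> [A [B [uA uB ->]]] [A' [B' [uA' uB' ->]]]; exists (A' *m A), (B *m B').
by rewrite !unitmx_mul uA uB uA' uB' -lact_ract lactM ractM.
Qed.

Lemma lr_equiv_lact A Q : A \in unitmx -> lr_equiv Q (lact A Q).
Proof. by move=> uA; exists A, 1%:M; rewrite unitmx1 ract1. Qed.

Lemma lr_equiv_ract B Q : B \in unitmx -> lr_equiv Q (ract Q B).
Proof. by move=> uB; exists 1%:M, B; rewrite unitmx1 lact1. Qed.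

Lemma mulvec3 a b c (M : 'M[C]_3) :
  vec3 a b c *m M = a *: row i0 M + b *: row i1 M + c *: row i2 M.
Proof. by apply/rowP => j; rewrite !mxE sum_ord3 !vec3E. Qed.

Lemma row_mat3 (u v w : 'rV[C]_3) : (row i0 (mat3 u v w) = u) *
  (row i1 (mat3 u v w) = v) * (row i2 (mat3 u v w) = w).
Proof. by split; [split|]; apply/rowP => j; rewrite mxE mat3E. Qed.

Lemma complete_row (v : 'rV[C]_3) : v != 0 ->
  exists2 B, B \in unitmx & vec3 1 0 0 *m B = v.
Proof.
move=> v0; pose f u w := mat3 v u w.
suff [u [w d0]] : exists u w, \det (f u w) != 0.
  exists (f u w); first by rewrite unitmxE unitfE.
  by rewrite mulvec3 row_mat3 scale1r !scale0r !addr0.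
(* The two unit vectors follow cyclically, so that the determinant is the nonzero coordinate of [v]
   that was selected. *)
have [v00|v00] := eqVneq (v 0 i0) 0; last first.
  exists (vec3 0 1 0), (vec3 0 0 1); rewrite det3E !mat3E !vec3E.
  by apply: contraNneq v00 => <-; apply/eqP; ring.
have [v01|v01] := eqVneq (v 0 i1) 0; last first.
  exists (vec3 0 0 1), (vec3 1 0 0); rewrite det3E !mat3E !vec3E.
  by apply: contraNneq v01 => <-; apply/eqP; ring.
exists (vec3 1 0 0), (vec3 0 1 0); rewrite det3E !mat3E !vec3E.
apply: contraNneq v0 => E; rewrite [v]vec3_eta v00 v01.
have -> : v 0 i2 = 0 by rewrite -E; ring.
by apply/eqP/rowP => i; elim/ord3_ind: i; rewrite vec3E mxE.
Qed.

End Equivalence.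

Section Points.
Variable C : closedFieldType.
Notation triple := (3.-tuple {mpoly C[3]}).
Implicit Types Q : triple.

Definition jac_at (Q : triple) (x : 'rV[C]_3) : 'M[C]_3 :=
  map_mx (meval (x 0)) (jac Q).

Lemma det_jac_at Q (x : 'rV_3) : (det_jac Q).@[x 0] = \det (jac_at Q x).
Proof. by rewrite det_map_mx. Qed.

Lemma meval_lform (r x : 'rV[C]_3) :
  (lform r).@[x 0] = r 0 i0 * x 0 i0 + r 0 i1 * x 0 i1 + r 0 i2 * x 0 i2.
Proof. by rewrite lformE !mevalD !mevalZ !mevalXU. Qed.

Lemma jac_at_linear Q a x y : homog_triple 2 Q ->
  jac_at Q (a *: x + y) = a *: jac_at Q x + jac_at Q y.
Proof.
move=> hQ; apply/matrixP => i j; rewrite !mxE.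
have /homog1E[r ->] := mderiv_homog j (hQ i).
by rewrite !meval_lform !mxE; ring.
Qed.

Lemma jac_at0 Q : homog_triple 2 Q -> jac_at Q 0 = 0.
Proof.
move=> hQ; have := jac_at_linear 1 0 0 hQ.
by rewrite !scale1r addr0 => /esym/eqP; rewrite -subr_eq0 addrK => /eqP.
Qed.

(** The Jacobian matrix at z x + y is z M + N with [M] invertible; it is singular when z is an
    eigenvalue of -N M^-1. *)
Lemma det_jac_root Q (x y : 'rV_3) : homog_triple 2 Q -> (det_jac Q).@[x 0] != 0 ->
  exists z, (det_jac Q).@[(z *: x + y) 0] = 0.
Proof.
rewrite det_jac_at => hQ Jx; pose M := jac_at Q x; pose N := jac_at Q y.
have uM : M \in unitmx by rewrite unitmxE unitfE.
pose g := - (N *m invmx M).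
have [|z] := @closed_rootP _ (char_poly g) _; first by rewrite size_char_poly.
rewrite -eigenvalue_root_char => /eigenvalueP[v vg v0]; exists z.
rewrite det_jac_at jac_at_linear // -/M -/N; apply/eqP/det0P; exists v => //.
rewrite mulmxDr -scalemxAr scalemxAl -vg /g mulmxN mulNmx.
by rewrite -!mulmxA mulVmx // mulmx1 addNr.
Qed.

(** The points lie on distinct lines x2 = n x1 through (1:0:0), so any two of them span a line of
    the form x0 = al x1 + be x2. The first component of [Q] stays free. *)
Definition five_points (Q : triple) : Prop :=
  exists (z : nat -> C) (s : seq nat), [/\ uniq s, size s = 5 &
    forall n, n \in s -> forall i, i != i0 ->
      (tnth Q i).@[vec3 (z n) 1 n%:R 0] = 0].

Lemma hyp_five_points (Q : triple) : hyp Q ->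
  exists Q', [/\ lr_equiv Q Q', hyp Q' & five_points Q'].
Proof.
move=> hQ.
have [Q1 [EQ1 hQ1 zP]] : exists Q', [/\ lr_equiv Q Q', hyp Q' &
    forall y, exists z, (det_jac Q').@[(z *: vec3 1 0 0 + y) 0] = 0].
  (* A point off the cubic is moved to (1:0:0), and every line through it then meets the cubic at a
     point other than itself. In the remaining alternative z = 0 works trivially. *)
  have [[x Jx]|Jall] := pselect (exists x, (det_jac Q).@[(x : 'rV_3) 0] != 0);
    last first.
    exists Q; split=> //; first by have := lr_equiv_lact Q (unitmx1 C 3); rewrite lact1.
    by move=> y; exists 0; apply/eqP/negPn/negP => J0; apply: Jall; eexists; apply: J0.
  have x0 : x != 0.
    apply: contraNneq Jx => ->; have [h2 _ _ _] := hQ.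
    by rewrite det_jac_at jac_at0 // det0.
  have [B uB xB] := complete_row x0.
  have uBT : B^T \in unitmx by rewrite unitmx_tr.
  have h1 := hyp_ract uBT hQ; have [h2 _ _ _] := h1.
  exists (ract Q B^T); split=> //; first exact: lr_equiv_ract.
  move=> y; apply: (det_jac_root y h2).
  rewrite det_jac_ract mevalZ meval_comp_lin trmxK xB mulf_neq0 //.
  by rewrite -unitfE -unitmxE.
have {zP}zP n := cid (zP (vec3 0 1 n%:R)).
pose z n := sval (zP n).
have zE n : z n *: vec3 1 0 0 + vec3 0 1 n%:R = vec3 (z n) 1 n%:R.
  by apply/rowP => i; elim/ord3_ind: i; rewrite !mxE !tnth3E; ring.
have [_ _ _ /(_ (fun n => vec3 (z n) 1 n%:R))] := hQ1.
case=> [n|p [s [p0 us ss sP]]].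
  split; last by rewrite -zE; apply: (svalP (zP n)).
  by apply/eqP => /rowP/(_ i1); rewrite vec3E mxE; apply/eqP; rewrite oner_eq0.
(* A change of the target sends [p] to the first basis vector, which makes the last two components
   vanish at the five points. *)
have [B uB pB] := complete_row p0.
have uA : (invmx B)^T \in unitmx by rewrite unitmx_tr unitmx_inv.
exists (lact (invmx B)^T Q1); split.
- by apply: lr_equiv_trans EQ1 _; apply: lr_equiv_lact.
- exact: hyp_lact.
exists z, s; split=> // n ns i ni0; have [c cP] := sP n ns.
have /rowP/(_ i) := eval_lact (invmx B)^T Q1 (vec3 (z n) 1 n%:R).
rewrite mxE => ->; rewrite trmxK cP -pB -scalemxAl mulmxK // !mxE.
by move: i ni0; apply: ord3_ind; rewrite ?eqxx ?tnth3E ?mulr0.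
Qed.

End Points.

(** * A common linear factor *)

Section CommonLine.
Variable C : numClosedFieldType.
Notation form := {mpoly C[3]}.
Notation triple := (3.-tuple {mpoly C[3]}).
Implicit Types Q : triple.

(** A nonzero relation, completed to an invertible matrix, gives an equivalent map with a zero
    component, whose Jacobian matrix has a zero row. *)
Lemma jac_indep Q (v : 'rV[C]_3) : det_jac Q != 0 ->
  \sum_j v 0 j *: tnth Q j = 0 -> v = 0.
Proof.
move=> J0 vQ; apply/eqP; apply: contraNT J0 => v0.
have [B uB vB] := complete_row v0.
have dB : \det B != 0 by rewrite -unitfE -unitmxE.
have : det_jac (lact B Q) = 0.
  rewrite /det_jac (expand_det_row _ i0) big1 // => j _.
  rewrite mxE tnth_lact.
  suff -> : \sum_k B i0 k *: tnth Q k = 0 by rewrite raddf0 mul0r.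
  rewrite -[RHS]vQ; apply: eq_bigr => k _; congr (_ *: _).
  by rewrite -vB mulvec3 scale1r !scale0r !addr0 mxE.
by rewrite det_jac_lact => /eqP; rewrite scaler_eq0 (negPf dB).
Qed.

(** Divided differences: two quotients by differences of roots eliminate k1, a further one isolates
    k3. *)
Lemma quadratic_three_roots (k1 k2 k3 t1 t2 t3 : C) :
  t1 != t2 -> t1 != t3 -> t2 != t3 ->
  k1 + k2 * t1 + k3 * t1 ^+ 2 = 0 -> k1 + k2 * t2 + k3 * t2 ^+ 2 = 0 ->
  k1 + k2 * t3 + k3 * t3 ^+ 2 = 0 -> [/\ k1 = 0, k2 = 0 & k3 = 0].
Proof.
rewrite -subr_eq0 => h12; rewrite -subr_eq0 => h13; rewrite -subr_eq0 => h23 e1 e2 e3.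
have f12 : k2 + k3 * (t1 + t2) = 0.
  by apply: (mulfI h12); rewrite mulr0 -(subrr 0) -{1}e1 -e2; ring.
have f13 : k2 + k3 * (t1 + t3) = 0.
  by apply: (mulfI h13); rewrite mulr0 -(subrr 0) -{1}e1 -e3; ring.
have k30 : k3 = 0.
  by apply: (mulfI h23); rewrite mulr0 -(subrr 0) -{1}f12 -f13; ring.
move: f12 e1; rewrite k30 !mul0r !addr0 => ->.
by rewrite mul0r addr0.
Qed.

Lemma meval_qform a b c d e f (x : 'rV[C]_3) : (qform a b c d e f).@[x 0] =
  a * x 0 i0 ^+ 2 + b * x 0 i1 ^+ 2 + c * x 0 i2 ^+ 2
  + d * (x 0 i0 * x 0 i1) + e * (x 0 i0 * x 0 i2) + f * (x 0 i1 * x 0 i2).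
Proof. by rewrite !(mevalD, mevalZ, rmorphXn, rmorphM) /= !mevalXU. Qed.

(** On the line x0 = al x1 + be x2 the form becomes a quadratic k1 + k2 t + k3 t^2 with three roots,
    hence vanishes identically. *)
Lemma line_dvd_qform (q : form) al be (z t : 'I_3 -> C) : q \is 2.-homog ->
  injective t -> (forall i, z i = al + be * t i) ->
  (forall i, q.@[vec3 (z i) 1 (t i) 0] = 0) ->
  exists r, q = lform (vec3 1 (- al) (- be)) * lform r.
Proof.
move=> /homog2E[|a [b [c [d [e [f ->]]]]]]; first by rewrite pnatr_eq0.
move=> tI zE qz.
pose k1 := a * al ^+ 2 + b + d * al.
pose k2 := a * al * be *+ 2 + d * be + e * al + f.
pose k3 := a * be ^+ 2 + c + e * be.
have kE i : k1 + k2 * t i + k3 * t i ^+ 2 = 0.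
  by rewrite -(qz i) meval_qform !vec3E zE /k1 /k2 /k3; ring.
have tN i j : i != j -> t i != t j by apply: contraNneq => /tI ->.
have [] := quadratic_three_roots (tN i0 i1 _) (tN i0 i2 _) (tN i1 i2 _)
  (kE i0) (kE i1) (kE i2); rewrite ?eq_ord3 // => k10 k20 k30.
(* Quotient of the division by x0 - al x1 - be x2 in the variable x0; the remainder has exactly the
   coefficients k1, k2, k3. *)
exists (vec3 a (a * al + d) (a * be + e)).
rewrite !lformE !vec3E -[LHS]subr0 -[X in _ - X](_ : qform 0 k1 k3 0 0 k2 = 0); last first.
  by rewrite k10 k20 k30 /qform !scale0r !addr0.
rewrite /qform -!mul_mpolyC /k1 /k2 /k3 !(mpolyCD, mpolyCM, rmorphN, rmorphXn, rmorphMn) /=.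
rewrite mpolyC1 mpolyC0; ring.
Qed.

(** Bezout for two conics, by a pencil. If three of the points are collinear, their line divides
    both conics. Otherwise the member of the pencil through one more point of the line joining
    points 0 and 1 contains that line, and its residual line must carry points 2, 3 and 4. *)
Lemma common_line (f g : form) (z t : 'I_5 -> C) :
  f \is 2.-homog -> g \is 2.-homog ->
  (forall a b, a *: f + b *: g = 0 -> a = 0 /\ b = 0) -> injective t ->
  (forall i, f.@[vec3 (z i) 1 (t i) 0] = 0) ->
  (forall i, g.@[vec3 (z i) 1 (t i) 0] = 0) ->
  exists l u v, [/\ l != 0, f = lform l * lform u & g = lform l * lform v].
Proof.
move=> hf hg fgI tI fz gz.
have tN i j : i != j -> t i != t j by apply: contraNneq => /tI ->.
have done al be (k : 'I_3 -> 'I_5) : injective k ->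
    (forall i, z (k i) = al + be * t (k i)) -> 
    exists l u v, [/\ l != 0, f = lform l * lform u & g = lform l * lform v].
  move=> kI zk; have tkI : injective (t \o k) by apply: inj_comp.
  have [u uE] := line_dvd_qform (z := z \o k) hf tkI zk (fun i => fz (k i)).
  have [v vE] := line_dvd_qform (z := z \o k) hg tkI zk (fun i => gz (k i)).
  exists (vec3 1 (- al) (- be)), u, v; split=> //.
  by apply/eqP => /rowP/(_ i0); rewrite vec3E mxE; apply/eqP; rewrite oner_eq0.
pose o k : 'I_5 := inord k.
have oN a b : (a < 5)%N -> (b < 5)%N -> a != b -> o a != o b.
  by move=> a5 b5; rewrite -val_eqE /= !inordK.
pose be := (z (o 1) - z (o 0)) / (t (o 1) - t (o 0)).
pose al := z (o 0) - be * t (o 0).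
have z0 : z (o 0) = al + be * t (o 0) by rewrite /al; ring.
have z1 : z (o 1) = al + be * t (o 1).
  by rewrite /al /be; field; rewrite subr_eq0 tN // oN.
pose k3 (a b c : nat) (i : 'I_3) := o (tnth [tuple a; b; c] i).
have k3I a b c : (a < 5)%N -> (b < 5)%N -> (c < 5)%N -> a != b -> a != c -> b != c ->
    injective (k3 a b c).
  move=> a5 b5 c5 ab ac bc; apply: ord3_ind; apply: ord3_ind => //;
    rewrite /k3 !tnth3E => /eqP; rewrite ?(negPf (oN _ _ _ _ _)) // eq_sym;
    by rewrite ?(negPf (oN _ _ _ _ _)).
have on_l k : (1 < k < 5)%N -> z (o k) = al + be * t (o k) ->
    exists l u v, [/\ l != 0, f = lform l * lform u & g = lform l * lform v].
  move=> /andP[k1 k5] zk; apply: (done al be (k3 0 1 k)%N).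
    by apply: k3I => //; rewrite neq_ltn ?k1 ?(ltnW k1).
  by apply: ord3_ind; rewrite /k3 !tnth3E.
(* A third point on the line through points 0 and 1; the parameter of point 2 is borrowed only
   because it differs from theirs. *)
pose w := vec3 (al + be * t (o 2)) 1 (t (o 2)) : 'rV[C]_3.
pose z' := (fun i => al + be * t (k3 0 1 2 i)%N).
have onw (h : form) : h.@[w 0] = 0 -> h.@[vec3 (z (o 0)) 1 (t (o 0)) 0] = 0 ->
    h.@[vec3 (z (o 1)) 1 (t (o 1)) 0] = 0 ->
    forall i, h.@[vec3 (z' i) 1 (t (k3 0 1 2 i)%N) 0] = 0.
  by rewrite z0 z1 => hw h0 h1; apply: ord3_ind; rewrite /z' /k3 !tnth3E.
have tk : injective (t \o (k3 0 1 2)%N) by apply: inj_comp => //; apply: k3I.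
have [/andP[/eqP fw /eqP gw]|fgw] := boolP ((f.@[w 0] == 0) && (g.@[w 0] == 0)).
  have [u uE] := line_dvd_qform (z := z') hf tk (fun=> erefl) (onw f fw (fz _) (fz _)).
  have [v vE] := line_dvd_qform (z := z') hg tk (fun=> erefl) (onw g gw (gz _) (gz _)).
  exists (vec3 1 (- al) (- be)), u, v; split=> //.
  by apply/eqP => /rowP/(_ i0); rewrite vec3E mxE; apply/eqP; rewrite oner_eq0.
(* The member of the pencil that vanishes at [w]; it is nonzero because [f] and [g] are independent
   and do not both vanish there. *)
pose h := g.@[w 0] *: f + - f.@[w 0] *: g.
have hh : h \is 2.-homog by rewrite rpredD // dhomogZ.
have hz i : h.@[vec3 (z i) 1 (t i) 0] = 0.
  by rewrite mevalD !mevalZ fz gz !mulr0 addr0.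
have hw : h.@[w 0] = 0 by rewrite mevalD !mevalZ; ring.
have h0 : h != 0.
  apply: contraNneq fgw => /fgI[-> /eqP].
  by rewrite oppr_eq0 => ->; rewrite eqxx.
have [m hE] := line_dvd_qform (z := z') hh tk (fun=> erefl) (onw h hw (hz _) (hz _)).
have lm k : (1 < k < 5)%N -> (lform m).@[vec3 (z (o k)) 1 (t (o k)) 0] = 0 \/
    z (o k) = al + be * t (o k).
  move=> k5; have := hz (o k); rewrite hE mevalM => /eqP; rewrite mulf_eq0.
  case/orP => /eqP; last by left.
  by rewrite meval_lform !vec3E => e; right; apply/eqP; rewrite -subr_eq0 -e; apply/eqP; ring.
have [m2|] := lm 2 isT; last exact: on_l.
have [m3|] := lm 3 isT; last exact: on_l.
have [m4|] := lm 4 isT; last exact: on_l.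
move: m2 m3 m4; rewrite !meval_lform !vec3E => m2 m3 m4.
(* A line without x0-term passes through (1:0:0) and sees at most one parameter t, so two points on
   it force m = 0 and h = 0. *)
have [m0|m0] := eqVneq (m 0 i0) 0.
  have m02 : m 0 i2 = 0.
    have d : t (o 2) - t (o 3) != 0 by rewrite subr_eq0 tN // oN.
    have := congr2 (fun a b => a - b) m2 m3; rewrite subrr m0 => E.
    by apply: (mulIf d); rewrite mul0r -[RHS]E; ring.
  have m01 : m 0 i1 = 0 by rewrite -m2 m0 m02; ring.
  move: h0; rewrite hE [m]vec3_eta m0 m01 m02.
  by rewrite [lform (vec3 0 0 0)]lformE !vec3E !scale0r !addr0 mulr0 eqxx.
apply: (done (- m 0 i1 / m 0 i0) (- m 0 i2 / m 0 i0) (k3 2 3 4)%N); first exact: k3I.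
have zt k : m 0 i0 * z (o k) + m 0 i1 * 1 + m 0 i2 * t (o k) = 0 ->
    z (o k) = - m 0 i1 / m 0 i0 + - m 0 i2 / m 0 i0 * t (o k).
  by move=> e; apply: (mulfI m0); apply/eqP; rewrite -subr_eq0 -e; apply/eqP; field.
by apply: ord3_ind; rewrite /k3 !tnth3E; apply: zt.
Qed.

End CommonLine.

(** * Normal forms *)

Section NormalForms.
Variable C : numClosedFieldType.
Notation form := {mpoly C[3]}.
Notation triple := (3.-tuple {mpoly C[3]}).
Implicit Types Q : triple.

Lemma x0E : x0 C = lform (vec3 1 0 0).
Proof. by rewrite lformE !vec3E scale1r !scale0r !addr0. Qed.
Lemma x1E : x1 C = lform (vec3 0 1 0).
Proof. by rewrite lformE !vec3E scale1r !scale0r addr0 add0r. Qed.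
Lemma x2E : x2 C = lform (vec3 0 0 1).
Proof. by rewrite lformE !vec3E scale1r !scale0r !add0r. Qed.

Lemma lform_mul (u v : 'rV[C]_3) : lform u * lform v =
  qform (u 0 i0 * v 0 i0) (u 0 i1 * v 0 i1) (u 0 i2 * v 0 i2)
    (u 0 i0 * v 0 i1 + u 0 i1 * v 0 i0) (u 0 i0 * v 0 i2 + u 0 i2 * v 0 i0)
    (u 0 i1 * v 0 i2 + u 0 i2 * v 0 i1).
Proof. rewrite /qform !lformE -!mul_mpolyC !(mpolyCD, mpolyCM); ring. Qed.

Lemma qformZ (k a b c d e f : C) : k *: qform a b c d e f =
  qform (k * a) (k * b) (k * c) (k * d) (k * e) (k * f).
Proof. by rewrite /qform !scalerDr !scalerA. Qed.

Lemma qformD (a b c d e f a' b' c' d' e' f' : C) :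
  qform a b c d e f + qform a' b' c' d' e' f' =
  qform (a + a') (b + b') (c + c') (d + d') (e + e') (f + f').
Proof. rewrite /qform -!mul_mpolyC !mpolyCD; ring. Qed.

Lemma qformN (a b c d e f : C) : - qform a b c d e f =
  qform (- a) (- b) (- c) (- d) (- e) (- f).
Proof. by rewrite -scaleN1r qformZ !mulN1r. Qed.

Lemma comp_xE (B : 'M[C]_3) : (x0 C \mPo linear_triple B = lform (row i0 B)) *
  (x1 C \mPo linear_triple B = lform (row i1 B)) *
  (x2 C \mPo linear_triple B = lform (row i2 B)).
Proof. by rewrite !comp_mpolyXU -!tnth_nth !tnth_linear_triple. Qed.

Lemma lr_equiv_intro (N Q : triple) (A B : 'M[C]_3) :
  \det A != 0 -> \det B != 0 ->
  (forall i, tnth Q i = A i i0 *: (tnth N i0 \mPo linear_triple B) +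
     A i i1 *: (tnth N i1 \mPo linear_triple B) +
     A i i2 *: (tnth N i2 \mPo linear_triple B)) -> lr_equiv N Q.
Proof.
move=> dA dB QE; exists A, B; rewrite !unitmxE !unitfE; split=> //.
by apply: eq_from_tnth => i; rewrite tnth_lact sum_ord3 !tnth_ract.
Qed.

(** If every completion were singular, the unit vectors would show that all 2x2 minors of [l] and
    [b] vanish. The relation -b_k l + l_k b = 0 then gives l_k = 0 for each k, against
    independence. *)
Lemma complete_pair (l b : 'rV[C]_3) :
  (forall s t, s *: l + t *: b = 0 -> s = 0 /\ t = 0) ->
  exists c, \det (mat3 l b c) != 0.
Proof.
move=> ind; apply: contrapT => /forallNP c0.
have {}c0 c : \det (mat3 l b c) = 0 by apply/eqP/negPn/negP/c0.
have minor j k : l 0 k * b 0 j - b 0 k * l 0 j = 0.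
  have m0 := c0 (vec3 1 0 0); have m1 := c0 (vec3 0 1 0); have m2 := c0 (vec3 0 0 1).
  rewrite !det3E !mat3E !vec3E in m0 m1 m2.
  move: j k; apply: ord3_ind; apply: ord3_ind;
    first [ring | rewrite -[RHS]m0; ring | rewrite -[RHS]m1; ring
      | rewrite -[RHS]m2; ring | rewrite -[RHS]oppr0 -[in RHS]m0; ring
      | rewrite -[RHS]oppr0 -[in RHS]m1; ring | rewrite -[RHS]oppr0 -[in RHS]m2; ring].
have l0 : l = 0.
  apply/rowP => k; rewrite [RHS]mxE.
  have [] := ind (- b 0 k) (l 0 k) _; last by move=> _ ->.
  by apply/rowP => j; rewrite !mxE addrC mulNr minor.
have [] := ind 1 0 _; first by rewrite l0 scaler0 scale0r addr0.
by move/eqP; rewrite oner_eq0.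
Qed.

Lemma mulmx_mat3V (u v w : 'rV[C]_3) : mat3 u v w \in unitmx ->
  (u *m invmx (mat3 u v w) = vec3 1 0 0) * (v *m invmx (mat3 u v w) = vec3 0 1 0) *
  (w *m invmx (mat3 u v w) = vec3 0 0 1).
Proof.
move=> uM.
have E a b c : (a *: u + b *: v + c *: w) *m invmx (mat3 u v w) = vec3 a b c.
  by rewrite -(mulmxK uM (vec3 a b c)) mulvec3 !row_mat3.
by split; [split|]; rewrite -E; congr (_ *m _);
  rewrite !scale0r scale1r ?addr0 ?add0r.
Qed.

Lemma lformD (u v : 'rV[C]_3) : lform (u + v) = lform u + lform v.
Proof. by rewrite /lform -big_split; apply: eq_bigr => j _; rewrite mxE scalerDl. Qed.

Lemma lformZ k (u : 'rV[C]_3) : lform (k *: u) = k *: lform u.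
Proof.
by rewrite /lform scaler_sumr; apply: eq_bigr => j _; rewrite mxE scalerA.
Qed.

Lemma lform0 : lform 0 = 0 :> form.
Proof. by rewrite -(scale0r (0 : 'rV[C]_3)) lformZ scale0r. Qed.

Lemma contracted_line_coords Q : hyp Q -> five_points Q ->
  exists Q', [/\ lr_equiv Q Q', hyp Q' &
    (tnth Q' i0 = x0 C ^+ 2 /\ tnth Q' i1 = x0 C * x1 C) \/
    (tnth Q' i1 = x0 C * x1 C /\ tnth Q' i2 = x0 C * x2 C)].
Proof.
move=> hQ [z [s [us ss sP]]]; have [h2 _ J0 _] := hQ.
have ind a b : a *: tnth Q i1 + b *: tnth Q i2 = 0 -> a = 0 /\ b = 0.
  move=> ab; have /rowP v0 : vec3 0 a b = 0.
    by apply: (jac_indep J0); rewrite sum_ord3 !vec3E scale0r add0r.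
  by have := v0 i1; have := v0 i2; rewrite !vec3E !mxE.
pose t (i : 'I_5) : C := (nth 0%N s i)%:R.
have sz (i : 'I_5) : nth 0%N s i \in s by rewrite mem_nth // ss.
have tI : injective t.
  move=> i j /eqP; rewrite eqr_nat nth_uniq ?ss // => /eqP; exact: val_inj.
have [||l [u [v [l0 fE gE]]]] := common_line (f := tnth Q i1) (g := tnth Q i2)
  (z := fun i => z (nth 0%N s i)) (h2 _) (h2 _) ind tI.
- by move=> i; apply: sP => //; rewrite eq_ord3.
- by move=> i; apply: sP => //; rewrite eq_ord3.
have [d0|d0] := eqVneq (\det (mat3 l u v)) 0; last first.
  have uM : mat3 l u v \in unitmx by rewrite unitmxE unitfE.
  have uV : invmx (mat3 l u v) \in unitmx by rewrite unitmx_inv.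
  exists (ract Q (invmx (mat3 l u v))); split.
  - exact: lr_equiv_ract.
  - exact: hyp_ract.
  right; rewrite !tnth_ract fE gE !rmorphM /= !lform_comp.
  by rewrite !mulmx_mat3V // -x0E -x1E -x2E.
have [w w0] := det0P (introT eqP d0).
rewrite [w]vec3_eta mulvec3 !row_mat3 => wE.
(* A relation between [u] and [v] alone, multiplied by [l], would be a relation between two
   components of [Q]. *)
have l1 : w 0 i0 != 0.
  apply: contraNneq w0 => w00; apply/eqP.
  have [w1 w2] : w 0 i1 = 0 /\ w 0 i2 = 0.
    apply: ind; rewrite fE gE !scalerAr -mulrDr.
    suff -> : w 0 i1 *: lform u + w 0 i2 *: lform v =
      lform (w 0 i0 *: l + w 0 i1 *: u + w 0 i2 *: v) by rewrite wE lform0 mulr0.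
    by rewrite w00 scale0r add0r lformD !lformZ.
  by apply/rowP; apply: ord3_ind; rewrite mxE.
pose al := - w 0 i1 / w 0 i0; pose be := - w 0 i2 / w 0 i0.
have lE : l = al *: u + be *: v.
  apply: (scalerI l1); apply/eqP; rewrite -subr_eq0 -wE; apply/eqP/rowP => j.
  by rewrite !mxE /al /be; field.
(* The combination al f + be g equals l^2. The second component keeps [f] or [g], whichever has its
   other factor independent of [l], and the free component moves to the last place. *)
have [A [b [dA bI AQ]]] : exists A b, [/\ \det A != 0,
    (forall s t, s *: l + t *: b = 0 -> s = 0 /\ t = 0) &
    [/\ tnth (lact A Q) i0 = lform l * lform l & tnth (lact A Q) i1 = lform l * lform b]].
  have lin c d b : c *: u + d *: v = b ->
      c *: tnth Q i1 + d *: tnth Q i2 = lform l * lform b.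
    by move=> <-; rewrite fE gE !scalerAr -mulrDr lformD !lformZ.
  have uvI c d : c *: u + d *: v = 0 -> c = 0 /\ d = 0.
    by move=> /lin; rewrite lform0 mulr0 => /ind.
  have [al0|al0] := eqVneq al 0.
    have be0 : be != 0.
      by apply: contraNneq l0 => be0; rewrite lE al0 be0 !scale0r addr0.
    exists (mat3 (vec3 0 al be) (vec3 0 1 0) (vec3 1 0 0)), u; split.
    - rewrite det3E !mat3E !vec3E al0; apply: contraNneq be0 => E.
      by rewrite -oppr_eq0; apply/eqP; rewrite -[RHS]E; ring.
    - move=> c d; rewrite lE al0 scale0r add0r scalerA addrC => /uvI[-> /eqP].
      by rewrite mulf_eq0 (negPf be0) orbF => /eqP.
    - rewrite !tnth_lact !sum_ord3 !mat3E !vec3E !scale0r !add0r addr0.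
      by split; [apply: lin | rewrite scale1r].
  exists (mat3 (vec3 0 al be) (vec3 0 0 1) (vec3 1 0 0)), v; split.
  - rewrite det3E !mat3E !vec3E; apply: contraNneq al0 => E.
    by apply/eqP; rewrite -[RHS]E; ring.
  - move=> c d; rewrite {1}lE scalerDr !scalerA -addrA -scalerDl => /uvI[/eqP].
    rewrite mulf_eq0 (negPf al0) orbF => /eqP -> /eqP.
    by rewrite mul0r add0r => /eqP.
  - rewrite !tnth_lact !sum_ord3 !mat3E !vec3E !scale0r !add0r.
    by split; [apply: lin | rewrite scale1r].
have [c dc] := complete_pair bI.
have uA : A \in unitmx by rewrite unitmxE unitfE.
have uM : mat3 l b c \in unitmx by rewrite unitmxE unitfE.
have uV : invmx (mat3 l b c) \in unitmx by rewrite unitmx_inv.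
exists (ract (lact A Q) (invmx (mat3 l b c))); split.
- by apply: lr_equiv_trans (lr_equiv_lact _ uA) _; apply: lr_equiv_ract.
- exact: hyp_ract uV (hyp_lact uA hQ).
have [[lV bV] _] := mulmx_mat3V uM; case: AQ => e0 e1; left.
rewrite !(tnth_ract (lact A Q)) e0 e1 !rmorphM /= !lform_comp lV bV.
by rewrite -x0E -x1E expr2.
Qed.

End NormalForms.

(** * Reduction of the two coordinate shapes to [sigma], [rho] and [tau] *)

Section Classification.
Variable C : numClosedFieldType.
Notation form := {mpoly C[3]}.
Notation triple := (3.-tuple {mpoly C[3]}).
Implicit Types Q : triple.

Lemma mderiv_x j : (mderiv j (x0 C) = (i0 == j)%:R) *
  (mderiv j (x1 C) = (i1 == j)%:R) * (mderiv j (x2 C) = (i2 == j)%:R).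
Proof.
rewrite x0E x1E x2E !mderiv_lform; move: j.
by apply: ord3_ind; rewrite !vec3E ?eq_ord3.
Qed.

Lemma mderiv_qform (a b c d e f : C) :
  (mderiv i0 (qform a b c d e f) = lform (vec3 (a *+ 2) d e)) *
  (mderiv i1 (qform a b c d e f) = lform (vec3 d (b *+ 2) f)) *
  (mderiv i2 (qform a b c d e f) = lform (vec3 e f (c *+ 2))).
Proof.
rewrite /qform !lformE !vec3E !(mderivD, mderivZ, expr2, mderivM) !mderiv_x.
rewrite !eq_ord3 -!mul_mpolyC !mpolyCMn /=.
split; [split|]; ring.
Qed.

Lemma det_jacE Q : det_jac Q =
  mderiv i0 (tnth Q i0) * (mderiv i1 (tnth Q i1) * mderiv i2 (tnth Q i2)
    - mderiv i2 (tnth Q i1) * mderiv i1 (tnth Q i2))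
  - mderiv i1 (tnth Q i0) * (mderiv i0 (tnth Q i1) * mderiv i2 (tnth Q i2)
    - mderiv i2 (tnth Q i1) * mderiv i0 (tnth Q i2))
  + mderiv i2 (tnth Q i0) * (mderiv i0 (tnth Q i1) * mderiv i1 (tnth Q i2)
    - mderiv i1 (tnth Q i1) * mderiv i0 (tnth Q i2)).
Proof. by rewrite /det_jac det3E !mxE. Qed.

(** The Jacobian matrix is lower triangular; the linear factor is the x2-derivative of the last
    component. *)
Lemma det_jac_tangent Q a b c d e f :
  tnth Q i0 = x0 C ^+ 2 -> tnth Q i1 = x0 C * x1 C ->
  tnth Q i2 = qform a b c d e f ->
  det_jac Q = 2%:R * x0 C ^+ 2 * lform (vec3 e f (c *+ 2)).
Proof.
move=> q0 q1 q2; rewrite det_jacE q0 q1 q2 !mderiv_qform expr2 !mderivM.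
by rewrite !mderiv_x !eq_ord3 /=; ring.
Qed.

(** With q the first component, the determinant is x0 (x0 q_0 - x1 q_1 - x2 q_2) in terms of its
    partial derivatives; the mixed terms d and e cancel. *)
Lemma det_jac_transverse Q a b c d e f :
  tnth Q i0 = qform a b c d e f -> tnth Q i1 = x0 C * x1 C ->
  tnth Q i2 = x0 C * x2 C ->
  det_jac Q = 2%:R * x0 C * qform a (- b) (- c) 0 0 (- f).
Proof.
move=> q0 q1 q2; rewrite det_jacE q0 q1 q2 !mderiv_qform !mderivM.
rewrite !mderiv_x !eq_ord3 /= !lformE !vec3E /qform.
rewrite -!mul_mpolyC !mpolyCN !mpolyCMn mpolyC0; ring.
Qed.

(** Two points of the pigeonhole fibre suffice: both have the ratio p_j / p_i, although the ratios t
    n are pairwise distinct. This is how contraction eliminates coefficients. *)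
Lemma pigeon_ratio Q (x : nat -> 'rV[C]_3) (t : nat -> C) i j : pigeon Q ->
  injective t -> (forall n, x n != 0) ->
  (forall n, (det_jac Q).@[x n 0] = 0) ->
  (forall n, (tnth Q i).@[x n 0] != 0) ->
  (forall n, (tnth Q j).@[x n 0] = t n * (tnth Q i).@[x n 0]) -> False.
Proof.
move=> pQ tI xn0 Jx Qi Qj; have [n|p [s [p0 us ss sP]]] := pQ x; first by split.
case: s us ss sP => [//|n [//|m s]] /= /andP[]; rewrite inE negb_or => /andP[nm _] _ _ sP.
have r k : k \in [:: n, m & s] -> p 0 j = t k * p 0 i.
  move=> /sP[c /rowP cP]; have := cP i; have := cP j; rewrite !mxE Qj => Ej Ei.
  have c0 : c != 0 by apply: contraNneq (Qi k) => c0; rewrite Ei c0 mul0r.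
  by apply: (mulfI c0); rewrite -Ej Ei mulrCA.
have pi0 : p 0 i != 0.
  have [|c /rowP/(_ i)] := sP n; first by rewrite inE eqxx.
  rewrite !mxE => Ei; apply: contraNneq (Qi n) => pi0.
  by rewrite Ei pi0 mulr0.
have : t n * p 0 i = t m * p 0 i.
  by rewrite -!r // !inE eqxx ?orbT.
by move=> /(mulIf pi0)/tI/eqP; rewrite (negPf nm).
Qed.

Lemma not_all_divisible_x0 Q q0 q1 q2 : no_common_factor Q ->
  tnth Q i0 = x0 C * q0 -> tnth Q i1 = x0 C * q1 -> tnth Q i2 = x0 C * q2 -> False.
Proof.
move=> ncf e0 e1 e2.
have : x0 C \is a GRing.unit.
  apply: ncf; apply: ord3_ind; [exists q0 | exists q1 | exists q2]; by [].
move=> /(rmorph_unit (meval (fun=> 0 : C))) /=.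
by rewrite mevalXU unitr0.
Qed.

Lemma natr_inj : injective (fun n : nat => n%:R : C).
Proof. by move=> m n /eqP; rewrite eqr_nat => /eqP. Qed.

Lemma vec3_neq0 (a b c : C) : b != 0 -> vec3 a b c != 0.
Proof. by apply: contraNneq => /rowP/(_ i1); rewrite vec3E mxE => ->. Qed.

Lemma tnth_sigma : (tnth (@sigma C) i0 = x1 C * x2 C) *
  (tnth (@sigma C) i1 = x0 C * x2 C) * (tnth (@sigma C) i2 = x0 C * x1 C).
Proof. by rewrite /sigma !tnth3E. Qed.

Lemma tnth_rho : (tnth (@rho C) i0 = x0 C * x1 C) *
  (tnth (@rho C) i1 = x2 C * x2 C) * (tnth (@rho C) i2 = x1 C * x2 C).
Proof. by rewrite /rho !tnth3E expr2. Qed.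

Lemma tnth_tau : (tnth (@tau C) i0 = x0 C * x0 C) *
  (tnth (@tau C) i1 = x0 C * x1 C) *
  (tnth (@tau C) i2 = x1 C * x1 C - x0 C * x2 C).
Proof. by rewrite /tau !tnth3E !expr2. Qed.

Lemma eq_qform (a b c d e f a' b' c' d' e' f' : C) : a = a' -> b = b' -> c = c' ->
  d = d' -> e = e' -> f = f' -> qform a b c d e f = qform a' b' c' d' e' f'.
Proof. by move=> -> -> -> -> -> ->. Qed.

Lemma classify_tangent Q : hyp Q ->
  tnth Q i0 = x0 C ^+ 2 -> tnth Q i1 = x0 C * x1 C ->
  lr_equiv rho Q \/ lr_equiv tau Q.
Proof.
move=> [h2 ncf J0 pQ] q0 q1.
have [|a [b [c [d [e [f q2]]]]]] := homog2E _ (h2 i2); first by rewrite pnatr_eq0.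
have JE := det_jac_tangent q0 q1 q2.
(* For c nonzero, the linear factor of the Jacobian contains the points (1 : n : z n), where the
   second component is n times the first. *)
have c0 : c = 0.
  apply: contrapT => /eqP c0.
  pose z (n : nat) := - (e + f * n%:R) / (c *+ 2).
  have c2 : c *+ 2 != 0 by rewrite mulrn_eq0.
  apply: (pigeon_ratio (x := fun n => vec3 1 n%:R (z n)) (t := fun n => n%:R)
    (i := i0) (j := i1) pQ).
  - exact: natr_inj.
  - move=> n; apply/eqP => /rowP/(_ i0); rewrite vec3E mxE.
    by apply/eqP; rewrite oner_eq0.
  - move=> n; rewrite JE mevalM meval_lform !vec3E /z.
    by apply/eqP; rewrite mulf_eq0; apply/orP; right; apply/eqP; field.
  - by move=> n; rewrite q0 rmorphXn /= mevalXU vec3E expr1n oner_eq0.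
  - by move=> n; rewrite q0 q1 rmorphXn mevalM /= !mevalXU !vec3E; ring.
rewrite c0 in q2 JE.
have [f0|f0] := eqVneq f 0.
  have e0 : e != 0.
    apply: contraNneq J0 => e0; rewrite JE f0 e0 mul0rn.
    by rewrite (_ : vec3 0 0 0 = 0) ?lform0 ?mulr0 //; apply/rowP; apply: ord3_ind;
       rewrite vec3E mxE.
  have b0 : b != 0.
    apply/eqP => b0; apply: (not_all_divisible_x0 (q0 := x0 C) (q1 := x1 C)
      (q2 := lform (vec3 a d e)) ncf) => //.
    rewrite q2 x0E lform_mul !vec3E b0 f0; apply: eq_qform; ring.
  (* Scaling x2 by -e/b turns b (x1^2 - x0 x2) into b x1^2 + e x0 x2; the terms in x0^2 and x0 x1
     are added from the first two components. *)
  right; apply: (@lr_equiv_intro _ _ _ (mat3 (vec3 1 0 0) (vec3 0 1 0) (vec3 a d b))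
    (mat3 (vec3 1 0 0) (vec3 0 1 0) (vec3 0 0 (- e / b)))).
  - by rewrite det3E !mat3E !vec3E; apply: contraNneq b0 => E; apply/eqP; rewrite -[RHS]E; ring.
  - have : - e / b != 0 by rewrite mulf_neq0 ?oppr_eq0 ?invr_eq0.
    rewrite det3E !mat3E !vec3E; apply: contraNneq => E; apply/eqP; rewrite -[RHS]E; ring.
  have QE i : tnth Q i = tnth [tuple x0 C * x0 C; x0 C * x1 C; qform a b 0 d e 0] i.
    by move: i; apply: ord3_ind; rewrite tnth3E ?q0 ?q1 ?q2 ?f0.
  move=> i; rewrite QE !tnth_tau rmorphB !rmorphM /= !comp_xE !row_mat3.
  rewrite !lform_mul qformN !(qformZ, qformD) !vec3E.
  move: i; apply: ord3_ind; rewrite tnth3E !mat3E !vec3E ?x0E ?x1E ?lform_mul ?vec3E;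
    apply: eq_qform; field; rewrite ?b0 //.
(* With y1 = e x0 + f x1, y2 = x0 and y0 = (b e / f^2) x0 + (b / f) x1 + x2, the product y0 y1
   absorbs the terms in x1^2, x0 x2 and x1 x2. What remains is al x0^2 + be x0 x1, a combination of
   y2^2 and y1 y2. *)
left; pose al := a - b / f ^+ 2 * e ^+ 2; pose be := d - b / f * e *+ 2.
apply: (@lr_equiv_intro _ _ _ (mat3 (vec3 0 1 0) (vec3 0 (- e / f) f^-1)
    (vec3 1 (al - be * e / f) (be / f)))
    (mat3 (vec3 (b / f ^+ 2 * e) (b / f) 1) (vec3 e f 0) (vec3 1 0 0))).
- rewrite det3E !mat3E !vec3E; apply: contraNneq (invr_neq0 f0) => E.
  by apply/eqP; rewrite -[RHS]E; ring.
- rewrite det3E !mat3E !vec3E -oppr_eq0; apply: contraNneq f0 => E.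
  by apply/eqP; rewrite -[RHS]E; ring.
have QE i : tnth Q i = tnth [tuple x0 C * x0 C; x0 C * x1 C; qform a b 0 d e f] i.
  by move: i; apply: ord3_ind; rewrite tnth3E ?q0 ?q1 ?q2.
move=> i; rewrite QE !tnth_rho !rmorphM /= !comp_xE !row_mat3.
rewrite !lform_mul !(qformZ, qformD) !vec3E.
move: i; apply: ord3_ind; rewrite tnth3E !mat3E !vec3E ?x0E ?x1E ?lform_mul ?vec3E;
  apply: eq_qform; rewrite /al /be; field; rewrite ?f0 //.
Qed.

(** Otherwise roots exist beyond every bound, and three distinct ones make all coefficients
    vanish. *)
Lemma binary_quadratic_nonzero (b c f : C) : [|| b != 0, c != 0 | f != 0] ->
  exists N, forall n, b + f * (n + N)%:R + c * (n + N)%:R ^+ 2 != 0.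
Proof.
move=> nz; apply: contrapT => /forallNP bad.
have {}bad N : exists2 n, (N <= n)%N & b + f * n%:R + c * n%:R ^+ 2 = 0.
  have /existsNP[n /negP] := bad N; rewrite negbK => /eqP E.
  by exists (n + N)%N; rewrite ?leq_addl.
have [n1 _ e1] := bad 0%N; have [n2 l12 e2] := bad n1.+1.
have [n3 l23 e3] := bad n2.+1.
have l13 := ltn_trans l12 l23.
have ne m n : (m < n)%N -> m%:R != n%:R :> C by rewrite eqr_nat neq_ltn => ->.
have [b0 f0 c0] := quadratic_three_roots (ne _ _ l12) (ne _ _ l13) (ne _ _ l23) e1 e2 e3.
by move: nz; rewrite b0 f0 c0 eqxx.
Qed.

(** Factorisation of b X^2 + f X Y + c Y^2 as (p X + q Y)(r X + s Y). For b nonzero the factors are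
    X - al Y, with al a root given by the quadratic formula, and its cofactor. *)
Lemma binary_quadratic_factor (b c f : C) : exists p q r s,
  [/\ b = p * r, c = q * s & f = p * s + q * r].
Proof.
have [->|b0] := eqVneq b 0.
  by exists 0, 1, f, c; rewrite !mul0r !mul1r add0r.
pose al := (sqrtC (f ^+ 2 - 4%:R * b * c) - f) / (2%:R * b).
have n2 : 2%:R != 0 :> C by rewrite pnatr_eq0.
have alE : b * al ^+ 2 + f * al + c = 0.
  have := sqrtCK (f ^+ 2 - 4%:R * b * c); rewrite /al; set s := sqrtC _ => sE.
  have cE : c = (f ^+ 2 - s ^+ 2) / (4%:R * b) by rewrite sE; field; rewrite b0.
  by rewrite cE; field; rewrite b0.
exists 1, (- al), b, (f + b * al); split; rewrite ?mul1r //; last by ring.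
by apply/eqP; rewrite -subr_eq0 -alE; apply/eqP; ring.
Qed.

Lemma classify_transverse Q : hyp Q ->
  tnth Q i1 = x0 C * x1 C -> tnth Q i2 = x0 C * x2 C ->
  lr_equiv sigma Q \/ lr_equiv rho Q.
Proof.
move=> [h2 ncf J0 pQ] q1 q2.
have [|a [b [c [d [e [f q0]]]]]] := homog2E _ (h2 i0); first by rewrite pnatr_eq0.
have JE := det_jac_transverse q0 q1 q2.
have nz : [|| b != 0, c != 0 | f != 0].
  apply: contraT; rewrite !negb_or !negbK => /and3P[/eqP b0 /eqP c0 /eqP f0].
  exfalso; apply: (not_all_divisible_x0 (q0 := lform (vec3 a d e)) (q1 := x1 C)
    (q2 := x2 C) ncf) => //.
  rewrite q0 x0E lform_mul !vec3E b0 c0 f0; apply: eq_qform; ring.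
(* For a nonzero, the quadratic factor of the Jacobian is solved for x0 by a square root at (x1, x2)
   = (1, n + N). The shift by N keeps x0 nonzero, and the last two components have ratio n + N. *)
have a0 : a = 0.
  apply: contrapT => /eqP a0; have [N NP] := binary_quadratic_nonzero nz.
  pose A n := b + f * (n + N)%:R + c * (n + N)%:R ^+ 2.
  pose s n := sqrtC (A n / a).
  have s2 n : s n ^+ 2 = A n / a by apply: sqrtCK.
  have s0 n : s n != 0 by rewrite sqrtC_eq0 mulf_neq0 ?invr_eq0 ?NP.
  apply: (pigeon_ratio (x := fun n => vec3 (s n) 1 (n + N)%:R)
     (t := fun n => (n + N)%:R) (i := i1) (j := i2) pQ).
  - by move=> m n /natr_inj/addIn.
  - by move=> n; apply: vec3_neq0; rewrite oner_eq0.
  - move=> n; rewrite JE mevalM meval_qform !vec3E s2 /A.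
    by apply/eqP; rewrite mulf_eq0; apply/orP; right; apply/eqP; field.
  - by move=> n; rewrite q1 mevalM !mevalXU !vec3E mulr1.
  - by move=> n; rewrite q1 q2 !mevalM !mevalXU !vec3E; ring.
have {nz} : ~ [/\ b = 0, c = 0 & f = 0].
  by move=> [b0 c0 f0]; move: nz; rewrite b0 c0 f0 eqxx.
have [p [q [r [s [bE cE fE]]]]] := binary_quadratic_factor b c f.
rewrite {}a0 {}bE {}cE {}fE in q0 *.
have QE i : tnth Q i = tnth [tuple qform 0 (p * r) (q * s) d e (p * s + q * r);
    x0 C * x1 C; x0 C * x2 C] i.
  by move: i; apply: ord3_ind; rewrite tnth3E ?q0 ?q1 ?q2.
(* Independent factors p x1 + q x2 and r x1 + s x2 together with x0 are the coordinates of [sigma];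
   the terms d x0 x1 + e x0 x2 lie in the span of the last two components. *)
have [D0|D0] := eqVneq (p * s - q * r) 0; last first.
  left; apply: (@lr_equiv_intro _ _ _
    (mat3 (vec3 ((e * p - d * q) / (p * s - q * r)) ((d * s - e * r) / (p * s - q * r)) 1)
      (vec3 (- q / (p * s - q * r)) (s / (p * s - q * r)) 0)
      (vec3 (p / (p * s - q * r)) (- r / (p * s - q * r)) 0))
    (mat3 (vec3 0 p q) (vec3 0 r s) (vec3 1 0 0))).
  - have := invr_neq0 D0; rewrite -oppr_eq0 det3E !mat3E !vec3E; apply: contraNneq => E.
    by apply/eqP; rewrite -[RHS]E; field.
  - rewrite det3E !mat3E !vec3E; apply: contraNneq D0 => E.
    by apply/eqP; rewrite -[RHS]E; ring.
  move=> i; rewrite QE !tnth_sigma !rmorphM /= !comp_xE !row_mat3.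
  rewrite !lform_mul !(qformZ, qformD) !vec3E.
  move: i; apply: ord3_ind; rewrite tnth3E !mat3E !vec3E ?x0E ?x1E ?x2E ?lform_mul ?vec3E;
    apply: eq_qform; field; rewrite ?D0 //.
move=> nz; right.
(* The two factors are now proportional; k is nonzero because their product is. *)
have [k [k0 [rE sE]]] : exists k, k != 0 /\ (r = k * p /\ s = k * q).
  have [p0|p0] := eqVneq p 0.
    have q0' : q != 0.
      by apply/eqP => q0'; apply: nz; rewrite p0 q0' !mul0r addr0.
    have r0 : r = 0.
      by apply: (mulfI q0'); rewrite mulr0 -[RHS]oppr0 -[in RHS]D0 p0; ring.
    exists (s / q); rewrite p0 r0 mulr0 divfK //; split=> //.
    apply: mulf_neq0; last by rewrite invr_eq0.
    by apply/eqP => s0; apply: nz; rewrite r0 s0 !mulr0 addr0.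
  have sE : s = r / p * q.
    by apply: (mulfI p0); apply/eqP; rewrite -subr_eq0 -[X in _ == X]D0; apply/eqP; field.
  exists (r / p); rewrite divfK // -sE; split=> //.
  apply: mulf_neq0; last by rewrite invr_eq0.
  by apply/eqP => r0; apply: nz; rewrite sE r0 !(mulr0, mul0r) addr0.
(* Any form y0 = p' x1 + q' x2 independent of y2 = p x1 + q x2 completes the coordinates with y1 =
   x0; the product of the factors is k y2^2, as in [rho]. *)
have [p' [q' D]] : exists p' q', p * q' - q * p' != 0.
  have [p0|p0] := eqVneq p 0; last by exists 0, 1; rewrite mulr1 mulr0 subr0.
  exists (-1), 0; rewrite p0 mulr0 mulrN1 sub0r opprK.
  by apply/eqP => q0'; apply: nz; rewrite p0 q0' !mul0r addr0.
pose D' := p * q' - q * p'; rewrite -/D' in D.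
apply: (@lr_equiv_intro _ _ _
    (mat3 (vec3 ((e * p - d * q) / D') k ((d * q' - e * p') / D'))
      (vec3 (- q / D') 0 (q' / D')) (vec3 (p / D') 0 (- p' / D')))
    (mat3 (vec3 0 p' q') (vec3 1 0 0) (vec3 0 p q))).
- have : k / D' != 0 by rewrite mulf_neq0 ?invr_eq0.
  rewrite det3E !mat3E !vec3E; apply: contraNneq => E.
  by apply/eqP; rewrite -[RHS]E; rewrite /D'; field.
- rewrite det3E !mat3E !vec3E; apply: contraNneq D => E.
  by apply/eqP; rewrite -[RHS]E /D'; ring.
move=> i; rewrite QE !tnth_rho !rmorphM /= !comp_xE !row_mat3.
rewrite !lform_mul !(qformZ, qformD) !vec3E rE sE.
move: i; apply: ord3_ind; rewrite tnth3E !mat3E !vec3E ?x0E ?x1E ?x2E ?lform_mul ?vec3E;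
  apply: eq_qform; rewrite /D'; field; rewrite ?D //.
Qed.

End Classification.

(** * Birationality and Jacobians of the standard maps *)

Section Composition.
Variable C : fieldType.
Notation form := {mpoly C[3]}.
Notation triple := (3.-tuple {mpoly C[3]}).
Implicit Types F G H Q N : triple.

Lemma comp_mpolyA (p : form) G H : (p \mPo G) \mPo H = p \mPo comp_triple G H.
Proof.
elim/mpoly_gen_ind: p => [c|i|p q IHp IHq|p q IHp IHq].
- by rewrite !comp_mpolyC.
- by rewrite !comp_mpolyXU -!tnth_nth tnth_mktuple.
- by rewrite !comp_mpolyD IHp IHq.
- by rewrite !rmorphM /= IHp IHq.
Qed.

Lemma same_map_id F c : c != 0 -> (forall i, tnth F i = c * 'X_i) ->
  same_map F (id_triple C).
Proof.
have X0 (i : 'I_3) : 'X_i != 0 :> form.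
  by rewrite -msize_poly_eq0 msizeX.
move=> c0 FE; split.
- by exists i0; rewrite FE mulf_neq0.
- by exists i0; rewrite tnth_mktuple.
- by move=> i j; rewrite !FE !tnth_mktuple mulrAC.
Qed.

(** Here [c] is a polynomial: the square of [N] is the identity only as a rational map, after
    removal of this common factor. *)
Definition involution N : Prop := homog_triple 2 N /\
  exists2 c, c != 0 & forall i, tnth N i \mPo N = c * 'X_i.

(** The inverse of A N B is B^-1 N A^-1. The two composites are the same computation [key], used
    once for (A, B) and once for (B^-1, A^-1). *)
Lemma involution_birational N Q : involution N -> lr_equiv N Q -> birational Q.
Proof.
move=> [hN [c c0 cE]] [A [B [uA uB ->]]].
have key A' B' : A' \in unitmx -> B' \in unitmx -> forall i,
    tnth (comp_triple (lact (invmx B') (ract N (invmx A')))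
                      (lact A' (ract N B'))) i = (c \mPo linear_triple B') * 'X_i.
  move=> uA' uB' i.
  have linE : lact B' (id_triple C) = linear_triple B'.
    apply: eq_from_tnth => j; rewrite tnth_lact tnth_linear_triple.
    by apply: eq_bigr => k _; rewrite tnth_mktuple mxE.
  rewrite tnth_mktuple tnth_lact raddf_sum /=.
  transitivity ((c \mPo linear_triple B') * tnth (lact (invmx B') (linear_triple B')) i).
    rewrite tnth_lact mulr_sumr; apply: eq_bigr => j _.
    rewrite comp_mpolyZ tnth_ract comp_mpolyA.
    rewrite -[comp_triple _ _]/(lact (invmx A') (lact A' (ract N B'))) lactK //.
    rewrite -comp_mpolyA cE rmorphM /= comp_mpolyXU -tnth_nth.
    by rewrite scalerAr.
  by rewrite -linE lactK // tnth_mktuple.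
exists 2, (lact (invmx B) (ract N (invmx A))); split.
- by apply: homog_lact; apply: homog_ract.
- by apply: same_map_id (key A B uA uB); rewrite comp_lin_eq0.
- have uA' : invmx A \in unitmx by rewrite unitmx_inv.
  have uB' : invmx B \in unitmx by rewrite unitmx_inv.
  have := key _ _ uB' uA'; rewrite !invmxK => k.
  by apply: same_map_id k; rewrite comp_lin_eq0.
Qed.

End Composition.

Section StandardMaps.
Variable C : numClosedFieldType.
Notation form := {mpoly C[3]}.
Notation triple := (3.-tuple {mpoly C[3]}).
Implicit Types Q N : triple.

Lemma compXE (G : triple) : (x0 C \mPo G = tnth G i0) *
  (x1 C \mPo G = tnth G i1) * (x2 C \mPo G = tnth G i2).
Proof. by rewrite !comp_mpolyXU -!tnth_nth. Qed.

Lemma x_neq0 : (x0 C != 0) * (x1 C != 0) * (x2 C != 0).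
Proof. by rewrite -!msize_poly_eq0 !msizeX. Qed.

Lemma x_homog : (x0 C \is 1.-homog) * (x1 C \is 1.-homog) * (x2 C \is 1.-homog).
Proof. by rewrite x0E x1E x2E !lform_homog. Qed.

Lemma homog_tuple3 d (p q r : form) : p \is d.-homog -> q \is d.-homog ->
  r \is d.-homog -> homog_triple d [tuple p; q; r].
Proof. by move=> hp hq hr; apply: ord3_ind; rewrite tnth3E. Qed.

Lemma sigma_involution : involution (@sigma C).
Proof.
split; first by apply: homog_tuple3; apply: (@dhomogM _ _ _ 1 _ 1); rewrite x_homog.
exists (x0 C * x1 C * x2 C); first by rewrite !mulf_neq0 ?x_neq0.
apply: ord3_ind; rewrite !tnth_sigma rmorphM /= !compXE !tnth_sigma /x0 /x1 /x2; ring.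
Qed.

Lemma rho_involution : involution (@rho C).
Proof.
split.
  by apply: homog_tuple3; rewrite ?expr2; apply: (@dhomogM _ _ _ 1 _ 1); rewrite x_homog.
exists (x1 C * x2 C ^+ 2); first by rewrite mulf_neq0 ?expf_neq0 ?x_neq0.
apply: ord3_ind; rewrite !tnth_rho rmorphM /= !compXE !tnth_rho /x0 /x1 /x2; ring.
Qed.

Lemma tau_involution : involution (@tau C).
Proof.
split.
  apply: homog_tuple3; rewrite ?rpredB // ?expr2; apply: (@dhomogM _ _ _ 1 _ 1);
    by rewrite x_homog.
exists (x0 C ^+ 3); first by rewrite expf_neq0 ?x_neq0.
apply: ord3_ind; rewrite !tnth_tau ?rmorphB !rmorphM /= !compXE !tnth_tau /x0 /x1 /x2; ring.
Qed.

Lemma det_jac_sigma : det_jac (@sigma C) = 2%:R *: (x0 C * x1 C * x2 C).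
Proof.
rewrite det_jacE !tnth_sigma !mderivM !mderiv_x !eq_ord3 /= scaler_nat; ring.
Qed.

Lemma det_jac_rho : det_jac (@rho C) = - 2%:R *: (x2 C * x2 C * x1 C).
Proof.
rewrite det_jacE !tnth_rho !mderivM !mderiv_x !eq_ord3 /= scaleNr scaler_nat; ring.
Qed.

Lemma det_jac_tau : det_jac (@tau C) = - 2%:R *: (x0 C * x0 C * x0 C).
Proof.
rewrite det_jacE !tnth_tau !mderivB !mderivM !mderiv_x !eq_ord3 /= scaleNr scaler_nat; ring.
Qed.

End StandardMaps.

(** * Lines *)

Section Lines.
Variable C : numClosedFieldType.
Notation form := {mpoly C[3]}.
Notation triple := (3.-tuple {mpoly C[3]}).
Implicit Types Q N : triple.
Implicit Types l m : form.

Lemma same_line_sym l m : same_line l m -> same_line m l.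
Proof.
by move=> [c c0 ->]; exists c^-1; rewrite ?invr_eq0 // scalerA mulVf // scale1r.
Qed.

Lemma same_line_trans l m m' : same_line l m -> same_line m m' -> same_line l m'.
Proof.
by move=> [c c0 ->] [d d0 ->]; exists (d * c); rewrite ?mulf_neq0 // scalerA.
Qed.

Lemma lform_inj : injective (@lform C).
Proof.
move=> u v uv; apply/rowP => j.
by have := congr1 (mderiv j) uv; rewrite !mderiv_lform => /eqP; rewrite mpolyC_eq => /eqP.
Qed.

Lemma lform_eq0 (r : 'rV[C]_3) : (lform r == 0) = (r == 0).
Proof.
by apply/eqP/eqP => [|->]; [rewrite -(lform0 C) => /lform_inj | rewrite lform0].
Qed.

Lemma is_lineE l : is_line l -> exists2 r, r != 0 & l = lform r.
Proof.
by move=> [/homog1E[r ->]]; rewrite lform_eq0 => r0; exists r.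
Qed.

(** Infinitely many points of [l] are shared among three lines, so one of these contains two of them
    and must be [l]. *)
Lemma line_in_union l (m : 'I_3 -> form) : is_line l -> (forall i, is_line (m i)) ->
  (forall x : 'rV[C]_3, l.@[x 0] = 0 -> exists i, (m i).@[x 0] = 0) ->
  exists i, same_line l (m i).
Proof.
move=> /is_lineE[u u0 lE] ml lm; have [B uB uE] := complete_row u0.
(* In coordinates where [l] is x0 = 0, these are the points (0 : 1 : n). *)
pose y (n : nat) : 'rV[C]_3 := vec3 0 1 n%:R *m (invmx B)^T.
have yP (w : 'rV[C]_3) n : (lform w).@[y n 0] =
    (w *m invmx B) 0 i1 + (w *m invmx B) 0 i2 * n%:R.
  rewrite -meval_comp_lin lform_comp meval_lform !vec3E.
  by rewrite mulr0 add0r mulr1.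
have ly n : l.@[y n 0] = 0.
  by rewrite lE yP -uE mulmxK // !vec3E mul0r addr0.
have [f fP] : {f : nat -> 'I_3 | forall n, (m (f n)).@[y n 0] = 0}.
  exists (fun n => projT1 (cid (lm _ (ly n)))) => n.
  exact: (projT2 (cid (lm _ (ly n)))).
have [i infi] := @infinite_fiber _ f finite_finset.
have [X XV sX] := infinite_set_fset 2 infi.
have [a [b [ab fa fb]]] : exists a b, [/\ a != b, f a = i & f b = i].
  have us : uniq (enum_fset X) by apply: fset_uniq.
  have sub n : n \in enum_fset X -> f n = i by move=> nX; apply: XV.
  case: (enum_fset X) us sX sub => [//|a [//|b s]] /= /andP[]; rewrite inE negb_or.
  move=> /andP[ab _] _ _ sub; exists a, b; split=> //; apply: sub;
    by rewrite !inE eqxx ?orbT.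
exists i; have [w w0 mE] := is_lineE (ml i).
have va : (lform w).@[y a 0] = 0 by move: (fP a); rewrite fa -mE.
have vb : (lform w).@[y b 0] = 0 by move: (fP b); rewrite fb -mE.
move: va vb; rewrite !yP; set v := w *m invmx B => va vb.
have v2 : v 0 i2 = 0.
  have d : a%:R - b%:R != 0 :> C by rewrite subr_eq0 eqr_nat.
  apply: (mulIf d); rewrite mul0r; have := congr2 (fun a b => a - b) va vb.
  by rewrite subrr => E; rewrite -[RHS]E; ring.
have v1 : v 0 i1 = 0 by move: va; rewrite v2 mul0r addr0.
have wE : w = v 0 i0 *: u.
  rewrite -(mulmxKV uB w) -/v [v]vec3_eta v1 v2 -uE scalemxAl vec3E; congr (_ *m _).
  by apply/rowP; apply: ord3_ind; rewrite !mxE !tnth3E; ring.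
exists (v 0 i0); last by rewrite lE mE wE lformZ.
by apply: contraNneq w0 => v0; rewrite wE v0 scale0r.
Qed.

(** Both decompositions have the same zero locus, so each line of the first lies in the union of the
    second. Supports alone separate the three configurations. *)
Lemma union_of_lines_sub psi l0 l1 l2 m0 m1 m2 l :
  union_of_lines psi l0 l1 l2 -> union_of_lines psi m0 m1 m2 ->
  l \in [:: l0; l1; l2] -> exists2 m, m \in [:: m0; m1; m2] & same_line l m.
Proof.
move=> [L0 L1 L2 [c c0 psiL]] [M0 M1 M2 [d d0 psiM]] ll.
have psi0 (x : 'rV[C]_3) : l.@[x 0] = 0 -> psi.@[x 0] = 0.
  move: ll; rewrite !inE psiL mevalZ !mevalM.
  by case/or3P => /eqP -> ->; rewrite !(mul0r, mulr0).
have lL : is_line l by move: ll; rewrite !inE => /or3P[] /eqP ->.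
have [||i li] := @line_in_union l (tnth [tuple m0; m1; m2]) lL.
- by apply: ord3_ind; rewrite tnth3E.
- move=> x /psi0; rewrite psiM mevalZ !mevalM => /eqP.
  rewrite !mulf_eq0 (negPf d0) -orbA /= => /or3P[] /eqP e.
  + by exists i0; rewrite tnth3E.
  + by exists i1; rewrite tnth3E.
  + by exists i2; rewrite tnth3E.
by exists (tnth [tuple m0; m1; m2] i) => //; apply: mem_tnth.
Qed.

(** Three pairwise distinct lines cannot all be among the two lines [l] and [m]. *)
Lemma union_of_lines_distinct psi l0 l1 l2 l m :
  union_of_lines psi l0 l1 l2 -> pairwise_distinct l0 l1 l2 ->
  ~ union_of_lines psi l l m.
Proof.
move=> U [n01 n02 n12] U'.
have S k : k \in [:: l0; l1; l2] -> same_line k l \/ same_line k m.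
  move=> /(union_of_lines_sub U U')[k']; rewrite !inE => /or3P[] /eqP ->; auto.
have T (k k' k'' : form) : same_line k k'' -> same_line k' k'' -> same_line k k'.
  by move=> kk kk'; apply: same_line_trans kk (same_line_sym kk').
have [] := S l0; have [] := S l1; have [] := S l2; rewrite ?inE ?eqxx ?orbT //; eauto.
Qed.

Lemma union_of_lines_triple psi l m k :
  union_of_lines psi l l m -> ~ same_line l m -> ~ union_of_lines psi k k k.
Proof.
move=> U nlm U'; apply: nlm.
have S j : j \in [:: l; l; m] -> same_line j k.
  by move=> /(union_of_lines_sub U U')[k']; rewrite !inE => /or3P[] /eqP ->.
apply: (same_line_trans (S l _) (same_line_sym (S m _))).
  by rewrite inE eqxx.
by rewrite !inE eqxx !orbT.
Qed.

Lemma row_line (B : 'M[C]_3) i : B \in unitmx -> is_line (lform (row i B)).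
Proof.
move=> uB; split; first exact: lform_homog.
rewrite lform_eq0; apply: contraTneq uB => r0.
rewrite unitmxE unitfE negbK (expand_det_row _ i) big1 // => j _.
by move/rowP/(_ j): r0; rewrite !mxE => ->; rewrite mul0r.
Qed.

Lemma row_same_line (B : 'M[C]_3) i j : B \in unitmx -> i != j ->
  ~ same_line (lform (row i B)) (lform (row j B)).
Proof.
move=> uB ij [c _]; rewrite -lformZ => /lform_inj/(congr1 (mulmx^~ (invmx B))).
rewrite -scalemxAl -!row_mul mulmxV // => /rowP/(_ j); rewrite !mxE eqxx (negPf ij).
by rewrite mulr0 => /eqP; rewrite oner_eq0.
Qed.

Lemma row_not_concurrent (B : 'M[C]_3) : B \in unitmx ->
  ~ concurrent (lform (row i0 B)) (lform (row i1 B)) (lform (row i2 B)).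
Proof.
move=> uB [x x0 [e0 e1 e2]].
have uBT : B^T \in unitmx by rewrite unitmx_tr.
move/eqP: x0; apply; rewrite -(mulmxK uBT x) (_ : x *m B^T = 0) ?mul0mx //.
apply/rowP => i; rewrite [RHS]mxE.
have -> : (x *m B^T) 0 i = (lform (row i B)).@[x 0].
  by rewrite mxE sum_ord3 meval_lform !mxE !(mulrC (x 0 _)).
by move: i; apply: ord3_ind.
Qed.

(** The Jacobian of A N B is that of [N] with [B] substituted, up to the two determinants, and the
    substitution turns variables into the rows of [B]. *)
Lemma union_of_lines_equiv N Q k a b c : lr_equiv N Q -> k != 0 ->
  det_jac N = k *: ('X_a * 'X_b * 'X_c) -> exists2 B, B \in unitmx &
  union_of_lines (det_jac Q) (lform (row a B)) (lform (row b B)) (lform (row c B)).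
Proof.
move=> [A [B [uA uB ->]]] k0 JN; exists B => //; split; try exact: row_line.
exists (\det A * (\det B * k)).
  by rewrite !mulf_neq0 // -unitfE -unitmxE.
rewrite det_jac_lact det_jac_ract JN comp_mpolyZ !rmorphM /= !comp_mpolyXU.
by rewrite -!tnth_nth !tnth_linear_triple !scalerA !mulrA.
Qed.

(** Inverting both matrices recovers [N] exactly; the Jacobian hypothesis makes [N] a nonzero
    triple, as [same_map] demands. *)
Lemma lr_equiv_left_right N Q : det_jac N != 0 -> lr_equiv N Q ->
  left_right_equivalent Q N.
Proof.
move=> J0 [A [B [uA uB ->]]]; exists (invmx A), B; rewrite unitmx_inv; split=> //.
rewrite -[comp_triple _ _]/(lact (invmx A) (ract (lact A (ract N B)) (invmx B))).
rewrite -lact_ract lactK // ractM mulmxV // ract1.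
have nN : nonzero_triple N.
  apply: contrapT => /forallNP N0; move/eqP: J0; apply.
  rewrite /det_jac (expand_det_row _ i0) big1 // => j _.
  by have /negP := N0 i0; rewrite negbK mxE => /eqP ->; rewrite raddf0 mul0r.
by split=> // i j; rewrite mulrC.
Qed.

Lemma classification Q : hyp Q -> [\/ lr_equiv sigma Q, lr_equiv rho Q | lr_equiv tau Q].
Proof.
move=> /hyp_five_points[Q1 [E1 h1 f1]].
have [Q2 [E2 h2 form2]] := contracted_line_coords h1 f1.
have E : lr_equiv Q2 Q.
  by apply: lr_equiv_trans (lr_equiv_sym E2) (lr_equiv_sym E1).
case: form2 => -[e e'].
  by have [] := classify_tangent h2 e e' => N; [constructor 2|constructor 3];
     apply: lr_equiv_trans N E.
by have [] := classify_transverse h2 e e' => N; [constructor 1|constructor 2];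
   apply: lr_equiv_trans N E.
Qed.

Lemma contracts_hyp Q : purely_quadratic Q -> det_jac Q != 0 ->
  contracts Q (det_jac Q) -> hyp Q.
Proof. by move=> [h2 ncf] J0 cQ; split=> //; apply: contracts_pigeon. Qed.

Lemma repeated_non_concurrent l m : non_concurrent l l m.
Proof. by move=> [[nll _ _] _]; apply: nll; exists 1; rewrite ?oner_eq0 ?scale1r. Qed.

End Lines.

Theorem mainTheorem1 (R : realType) (Q : 3.-tuple {mpoly R[i][3]}) :
  purely_quadratic Q ->
  det_jac Q != 0 ->
  contracts Q (det_jac Q) ->
  (exists l0 l1 l2 : {mpoly R[i][3]},
     union_of_lines (det_jac Q) l0 l1 l2 /\ non_concurrent l0 l1 l2) /\
  birational Q /\
  ((exists l0 l1 l2 : {mpoly R[i][3]},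
      union_of_lines (det_jac Q) l0 l1 l2 /\ general_position l0 l1 l2) ->
   left_right_equivalent Q sigma) /\
  ((exists l m : {mpoly R[i][3]},
      union_of_lines (det_jac Q) l l m /\ ~ same_line l m) ->
   left_right_equivalent Q rho) /\
  ((exists l : {mpoly R[i][3]}, union_of_lines (det_jac Q) l l l) ->
   left_right_equivalent Q tau).
Proof.
move=> qQ J0 cQ; have hQ := contracts_hyp qQ J0 cQ.
have n2 : 2%:R != 0 :> R[i] by rewrite pnatr_eq0.
have n2' : - 2%:R != 0 :> R[i] by rewrite oppr_eq0.
(* In each case the matching conclusion comes from the equivalence itself, and the premises of the
   other two contradict the lines of the Jacobian. *)
have [E|E|E] := classification hQ.
- have [B uB U] := union_of_lines_equiv E n2 (det_jac_sigma _).
  have D : pairwise_distinct (lform (row i0 B)) (lform (row i1 B)) (lform (row i2 B)).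
    by split; apply: row_same_line; rewrite ?eq_ord3.
  do !split.
  + exists (lform (row i0 B)), (lform (row i1 B)), (lform (row i2 B)); split=> //.
    by move=> [_]; apply: row_not_concurrent.
  + exact: involution_birational (sigma_involution _) E.
  + move=> _; apply: lr_equiv_left_right E.
    by rewrite det_jac_sigma scaler_eq0 negb_or n2 !mulf_neq0 ?x_neq0.
  + by move=> [l [m [U' _]]]; case: (union_of_lines_distinct U D U').
  + by move=> [l U']; case: (union_of_lines_distinct U D U').
- have [B uB U] := union_of_lines_equiv E n2' (det_jac_rho _).
  have D : ~ same_line (lform (row i2 B)) (lform (row i1 B)).
    by apply: row_same_line; rewrite ?eq_ord3.
  do !split.
  (* The Jacobian of [rho] is -2 x2^2 x1, so row 2 of [B] is the double line and row 1 the simple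
     one. *)
  + exists (lform (row i2 B)), (lform (row i2 B)), (lform (row i1 B)); split=> //.
    exact: repeated_non_concurrent.
  + exact: involution_birational (rho_involution _) E.
  + by move=> [l0 [l1 [l2 [U' [D' _]]]]]; case: (union_of_lines_distinct U' D' U).
  + move=> _; apply: lr_equiv_left_right E.
    by rewrite det_jac_rho scaler_eq0 negb_or n2' !mulf_neq0 ?x_neq0.
  + by move=> [l U']; case: (union_of_lines_triple U D U').
- have [B uB U] := union_of_lines_equiv E n2' (det_jac_tau _).
  do !split.
  + exists (lform (row i0 B)), (lform (row i0 B)), (lform (row i0 B)); split=> //.
    exact: repeated_non_concurrent.
  + exact: involution_birational (tau_involution _) E.
  + by move=> [l0 [l1 [l2 [U' [D' _]]]]]; case: (union_of_lines_distinct U' D' U).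
  + by move=> [l [m [U' D]]]; case: (union_of_lines_triple U' D U).
  + move=> _; apply: lr_equiv_left_right E.
    by rewrite det_jac_tau scaler_eq0 negb_or n2' !mulf_neq0 ?x_neq0.
Qed.
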